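(* Let $a\in(\mathcal A,\tau)$ be a self-adjoint random variable with mean $\tau(a)=\lambda$ and variance $\operatorname{var}(a)=\sigma^2\neq 0$. Denote $$\delta^2:=\operatorname{var}(a\otimes a)=\sigma^2(\sigma^2+2\lambda^2),\qquad q:=\frac{2\lambda^2}{\sigma^2+2\lambda^2}\in[0,1].$$ Let $(a_k)_{k\in\mathbb N}$ be a sequence of free copies of $a$. Then the normalized sum $$S_n:=\frac{1}{\delta\sqrt n}\sum_{k=1}^n\left(a_k\otimes a_k-\lambda^2\right)\in(\mathcal A\otimes\mathcal A,\tau\otimes\tau)$$ converges in distribution, as $n\to\infty$, to $$\mu_q:=\sqrt q\left(\frac1{\sqrt2}\mu_{sc}+\frac1{\sqrt2}\mu_{sc}\right)\boxplus\sqrt{1-q}\,\mu_{sc},$$ where $+$ denotes the classical convolution and $\boxplus$ denotes the free convolution.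
   Context: $(\mathcal A,\tau)$ is a unital noncommutative probability space (unital $*$-algebra) equipped with a faithful tracial state $\tau$. Subalgebras $\mathcal A_1,\dots,\mathcal A_d\subset\mathcal A$ are free if $\tau(x_1\cdots x_m)=0$ whenever $m\ge1$, $x_i\in\mathcal A_{j_i}$, $\tau(x_i)=0$ for all $i$, and $j_1\ne j_2\ne\cdots\ne j_m$ (consecutive indices distinct); random variables are free if the unital algebras they generate are free. A sequence of free copies of $a$ means a sequence $(a_k)$ of free self-adjoint elements of $\mathcal A$, each with the same moments as $a$. The mean of $a$ is $\tau(a)$ and $\operatorname{var}(a)=\tau((a-\tau(a)\mathbf 1)^2)$ (similarly in the tensor product $(\mathcal A\otimes\mathcal A,\tau\otimes\tau)$); a scalar $\lambda^2$ in $a_k\otimes a_k-\lambda^2$ means $\lambda^2\,\mathbf 1\otimes\mathbf 1$, and $\delta>0$. Convergence in distribution of $S_n$ to a compactly supported probability measure $\mu$ on $\mathbb R$ means $\tau\otimes\tau(S_n^m)\to\int x^m\,d\mu(x)$ for all integers $m\ge0$. $\mu_{sc}$ is the semicircle distribution with density $\frac1{2\pi}\sqrt{4-x^2}\,\mathbf 1_{|x|\le2}$. For a measure $\mu$ and $t\ne0$, $t\mu$ denotes the dilation $(t\mu)(A)=\mu(t^{-1}A)$ (the law of $tX$ if $X$ has law $\mu$), with $0\mu:=\delta_0$ (the Dirac mass at $0$). $\mu+\nu$ denotes the classical convolution (the law of $X+Y$ with $X\sim\mu$, $Y\sim\nu$ classically independent), and $\mu\boxplus\nu$ the free convolution (the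 law of $x+y$ with $x,y$ free with laws $\mu,\nu$). *)

(* Defs.v *)
From HB Require Import structures.
From mathcomp Require Import all_boot all_order all_algebra.
From mathcomp Require Import all_classical all_reals all_analysis.
From mathcomp Require Import ring_quotient complex measurable_realfun.
From mathcomp Require Import ring lra.

Set Implicit Arguments.
Unset Strict Implicit.
Unset Printing Implicit Defensive.

Import Order.TTheory GRing.Theory Num.Theory.
Import numFieldNormedType.Exports.
Local Open Scope classical_set_scope.
Local Open Scope quotient_scope.
Local Open Scope ring_scope.

HB.mixin Record Algebra_isStarAlgebra (C : numClosedFieldType) A
    of GRing.Algebra C A := {
  star : A -> A;
  starK : involutive star;
  starD : {morph star : x y / x + y};
  starZ : forall (c : C) x, star (c *: x) = c^* *: star x;
  starM : forall x y, star (x * y) = star y * star x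
}.

#[short(type="starAlgType")]
HB.structure Definition StarAlgebra (C : numClosedFieldType) :=
  {A of Algebra_isStarAlgebra C A & GRing.Algebra C A}.

HB.mixin Record StarAlgebra_isNCProbSpace (C : numClosedFieldType) A
    of StarAlgebra C A := {
  tau : A -> C;
  tau_is_linear : linear_for *%R tau;
  tau1 : tau 1 = 1;
  tau_ge0 : forall x, 0 <= tau (star x * x);
  tau_faithful : forall x, tau (star x * x) = 0 -> x = 0;
  tau_trace : forall x y, tau (x * y) = tau (y * x)
}.

#[short(type="ncProbSpaceType")]
HB.structure Definition NCProbSpace (C : numClosedFieldType) :=
  {A of StarAlgebra_isNCProbSpace C A & StarAlgebra C A}.

HB.instance Definition _ (C : numClosedFieldType) (A : ncProbSpaceType C) :=
  GRing.isLinear.Build C A C *%R (tau : A -> C) tau_is_linear.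

Definition bilin (K : nzRingType) (U U' V : lmodType K) (f : U -> U' -> V) :=
  bilinear_for *:%R *:%R f.

(* A ⊗ B is the set of formal sums of pairs (a, b) modulo the relation        *)
(* "every bilinear map out of A x B takes the same value on both sums", i.e.  *)
(* the algebraic tensor product; see tlift_linear, tlift_pure, tlift_unique   *)
(* for its universal property.                                                *)
Section Tensor.
Variables (K : comNzRingType) (A B : lmodType K).

Definition tens_sum (V : lmodType K) (f : A -> B -> V) (s : seq (A * B)) : V :=
  \sum_(p <- s) f p.1 p.2.

Definition tens_rel (s t : seq (A * B)) : bool :=
  `[< forall (V : lmodType K) (f : A -> B -> V), bilin f ->
        tens_sum f s = tens_sum f t >].

Fact tens_rel_refl : reflexive tens_rel.
Proof. by move=> s; apply/asboolP. Qed.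
Fact tens_rel_sym : symmetric tens_rel.
Proof.
by move=> s t; apply/asboolP/asboolP => + V f bf => /(_ V f bf).
Qed.
Fact tens_rel_trans : transitive tens_rel.
Proof.
move=> s t u /asboolP ts /asboolP su; apply/asboolP => V f bf.
by rewrite ts// su.
Qed.

Definition tens_equiv := EquivRel tens_rel tens_rel_refl tens_rel_sym
  tens_rel_trans.

Definition tensor := {eq_quot tens_equiv}.

HB.instance Definition _ := Choice.on tensor.

Definition tpi (s : seq (A * B)) : tensor := \pi_{eq_quot tens_equiv} s.
Definition trepr (x : tensor) : seq (A * B) := repr (x : {eq_quot tens_equiv}).

Definition pure (a : A) (b : B) : tensor := tpi [:: (a, b)].

Definition tlift (V : lmodType K) (f : A -> B -> V) (x : tensor) : V :=
  tens_sum f (trepr x).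

Lemma tpi_trepr x : tpi (trepr x) = x.
Proof. by rewrite /tpi /trepr reprK. Qed.

Lemma tlift_tpi V f s : @bilin K A B V f -> tlift f (tpi s) = tens_sum f s.
Proof.
move=> bf; rewrite /tlift /tpi /trepr.
have : repr (\pi_{eq_quot tens_equiv} s) = s %[mod {eq_quot tens_equiv}].
  by rewrite reprK.
by move=> /eqmodP /asboolP /(_ V f bf).
Qed.

Lemma tens_ext (x y : tensor) :
  (forall (V : lmodType K) (f : A -> B -> V), bilin f ->
     tlift f x = tlift f y) -> x = y.
Proof.
move=> xy; rewrite -[x]tpi_trepr -[y]tpi_trepr.
by apply/eqmodP/asboolP => V f bf; exact: xy.
Qed.

Definition tens_zero : tensor := tpi [::].
Definition tens_add (x y : tensor) : tensor := tpi (trepr x ++ trepr y).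
Definition tens_scale (c : K) (x : tensor) : tensor :=
  tpi [seq (c *: p.1, p.2) | p <- trepr x].

Section lift.
Variables (V : lmodType K) (f : A -> B -> V).
Hypothesis bf : bilin f.

Lemma tens_sumZ c s :
  tens_sum f [seq (c *: p.1, p.2) | p <- s] = c *: tens_sum f s.
Proof.
rewrite /tens_sum big_map scaler_sumr; apply: eq_bigr => -[a b] _ /=.
exact: (scalable_linear (bf.1 b)).
Qed.

Lemma tlift0' : tlift f tens_zero = 0.
Proof. by rewrite tlift_tpi// /tens_sum big_nil. Qed.
Lemma tliftD' x y : tlift f (tens_add x y) = tlift f x + tlift f y.
Proof. by rewrite tlift_tpi// /tens_sum big_cat. Qed.
Lemma tliftZ' c x : tlift f (tens_scale c x) = c *: tlift f x.
Proof. by rewrite tlift_tpi// tens_sumZ. Qed.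
End lift.

Fact tens_addA : associative tens_add.
Proof. by move=> x y z; apply: tens_ext => V f bf; rewrite !tliftD'// addrA. Qed.
Fact tens_addC : commutative tens_add.
Proof. by move=> x y; apply: tens_ext => V f bf; rewrite !tliftD'// addrC. Qed.
Fact tens_add0 : left_id tens_zero tens_add.
Proof.
by move=> x; apply: tens_ext => V f bf; rewrite !tliftD'// tlift0'// add0r.
Qed.
Fact tens_addN : left_inverse tens_zero (tens_scale (- 1)) tens_add.
Proof.
move=> x; apply: tens_ext => V f bf.
by rewrite !tliftD'// tliftZ'// tlift0'// scaleN1r addNr.
Qed.

HB.instance Definition _ :=
  GRing.isZmodule.Build tensor tens_addA tens_addC tens_add0 tens_addN.

Fact tens_scaleA a b v :
  tens_scale a (tens_scale b v) = tens_scale (a * b) v.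
Proof. by apply: tens_ext => V f bf; rewrite !tliftZ'// scalerA. Qed.
Fact tens_scale1 : left_id 1 tens_scale.
Proof. by move=> v; apply: tens_ext => V f bf; rewrite !tliftZ'// scale1r. Qed.
Fact tens_scaleDr : right_distributive tens_scale +%R.
Proof.
move=> c x y; apply: tens_ext => V f bf.
by rewrite !(tliftZ', tliftD')// scalerDr.
Qed.
Fact tens_scaleDl v : {morph tens_scale^~ v : a b / a + b}.
Proof.
move=> a b; apply: tens_ext => V f bf.
by rewrite !(tliftZ', tliftD')// scalerDl.
Qed.

HB.instance Definition _ := GRing.Zmodule_isLmodule.Build K tensor
  tens_scaleA tens_scale1 tens_scaleDr tens_scaleDl.

Lemma tlift_linear (V : lmodType K) (f : A -> B -> V) : bilin f -> linear (tlift f).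
Proof. by move=> bf c x y; rewrite [LHS]tliftD'// tliftZ'. Qed.

Lemma tlift_pure (V : lmodType K) (f : A -> B -> V) a b : bilin f -> tlift f (pure a b) = f a b.
Proof. by move=> bf; rewrite tlift_tpi// /tens_sum big_seq1. Qed.

Lemma pure_bilin : bilin pure.
Proof.
split => [b c a a'|a c b b']; apply: tens_ext => V f bf;
  rewrite tlift_linear// !tlift_pure//.
- exact: (bf.1 b).
- exact: (bf.2 a).
Qed.

Lemma tensorE x : x = \sum_(p <- trepr x) pure p.1 p.2.
Proof.
apply: tens_ext => V f bf.
rewrite -{1}[x]tpi_trepr tlift_tpi//.
have lf := tlift_linear bf.
elim: (trepr x) => [|p s IH]; first by rewrite /tens_sum !big_nil [RHS]tlift0'.
rewrite /tens_sum !big_cons [RHS]tliftD'// tlift_pure//.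
by congr (_ + _); exact: IH.
Qed.

Lemma tens_ind (P : tensor -> Prop) : (forall a b, P (pure a b)) -> P 0 ->
  (forall x y, P x -> P y -> P (x + y)) -> forall x, P x.
Proof.
move=> Pp P0 PD x; rewrite [x]tensorE.
by apply: big_ind.
Qed.

Lemma tlift_unique (V : lmodType K) (f : A -> B -> V) (g : tensor -> V) :
  linear g -> (forall a b, g (pure a b) = f a b) -> g =1 tlift f.
Proof.
move=> lg gf x; rewrite {1}[x]tensorE /tlift /tens_sum.
have g0 : g 0 = 0.
  by have := lg (-1) 0 0; rewrite scaler0 addr0 scaleN1r addNr.
have gD u v : g (u + v) = g u + g v by have := lg 1 u v; rewrite !scale1r.
by rewrite (big_morph g gD g0); apply: eq_bigr => p _.
Qed.

Lemma tens_seq_ind (P : tensor -> Prop) : P 0 ->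
  (forall a b x, P x -> P (pure a b + x)) -> forall x, P x.
Proof.
by move=> P0 PD x; rewrite [x]tensorE; elim/big_rec: _ => // p y _; exact: PD.
Qed.

End Tensor.

Notation "a ⊗ b" := (pure a b) (at level 40, left associativity) : ring_scope.
Notation "A ⊗ B" := (tensor A B) (at level 40, left associativity) : type_scope.

(* V with scalars acting through conjugation: the involution of A ⊗ B is      *)
(* antilinear, hence obtained by lifting a linear map into the conjugate.     *)
Section ConjModule.
Variables (C : numClosedFieldType) (V : lmodType C).

Definition conjmod : Type := V.
HB.instance Definition _ := GRing.Zmodule.on conjmod.

Definition conj_scale (c : C) (v : conjmod) : conjmod := c^* *: (v : V).

Fact conj_scaleA a b v : conj_scale a (conj_scale b v) = conj_scale (a * b) v.
Proof. by rewrite /conj_scale scalerA -rmorphM. Qed.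
Fact conj_scale1 : left_id 1 conj_scale.
Proof. by move=> v; rewrite /conj_scale rmorph1 scale1r. Qed.
Fact conj_scaleDr : right_distributive conj_scale +%R.
Proof. by move=> c u v; exact: scalerDr. Qed.
Fact conj_scaleDl v : {morph conj_scale^~ v : a b / a + b}.
Proof. by move=> a b; rewrite /conj_scale rmorphD scalerDl. Qed.

HB.instance Definition _ := GRing.Zmodule_isLmodule.Build C conjmod
  conj_scaleA conj_scale1 conj_scaleDr conj_scaleDl.
End ConjModule.

Section StarTheory.
Variables (C : numClosedFieldType).

Lemma star0 (A : starAlgType C) : star 0 = 0 :> A.
Proof. by apply: (addIr (star 0)); rewrite -starD !add0r. Qed.

Lemma star1 (A : starAlgType C) : star 1 = 1 :> A.
Proof. by have := starM (star 1 : A) 1; rewrite mulr1 starK mulr1. Qed.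

Lemma tauD (A : ncProbSpaceType C) : {morph (tau : A -> C) : x y / x + y}.
Proof. by move=> x y; rewrite raddfD. Qed.

Lemma tauZ (A : ncProbSpaceType C) c (x : A) : tau (c *: x) = c * tau x.
Proof. by rewrite linearZ. Qed.

Lemma tau_star (A : ncProbSpaceType C) (x : A) : tau (star x) = (tau x)^*.
Proof.
have key (c : C) : c^* * tau (star x) + c * tau x \is Num.real.
  have -> : c^* * tau (star x) + c * tau x =
      tau (star (1 + c *: x) * (1 + c *: x)) - 1
      - (c^* * c) * tau (star x * x).
    rewrite starD star1 starZ mulrDl !mulrDr !mul1r !mulr1 -scalerAl -scalerAr.
    rewrite !tauD !tauZ tau1.
    ring.
  apply: rpredB; first by apply: rpredB; rewrite ?rpred1// ger0_real ?tau_ge0.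
  by rewrite ger0_real// mulr_ge0 ?tau_ge0// mulrC mul_conjC_ge0.
have /conj_Creal := key 1; have /conj_Creal := key 'i.
rewrite rmorph1 !mul1r !rmorphD !rmorphM/= !conjCK conjCi => e2 e1.
have {}e2 : (tau x)^* - (tau (star x))^* = tau (star x) - tau x.
  apply: (mulfI (neq0Ci C)); apply/eqP; rewrite -subr_eq0.
  move/eqP: e2; rewrite -subr_eq0 -oppr_eq0 => /eqP e2.
  by apply/eqP; rewrite -[RHS]e2; ring.
have h : tau (star x) *+ 2 = (tau x)^* *+ 2.
  rewrite !mulr2n.
  have -> : tau (star x) + tau (star x) =
    (tau (star x) + tau x) + (tau (star x) - tau x) by ring.
  by rewrite -e1 -e2; ring.
by apply: (@mulIf _ (2%:R : C)); rewrite ?pnatr_eq0// !mulr_natr.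
Qed.
End StarTheory.

Section TensorAlgebra.
Variables (C : numClosedFieldType) (A B : ncProbSpaceType C).
Local Notation T := (A ⊗ B)%type.

Lemma tpureDl (a a' : A) (b : B) : (a + a') ⊗ b = a ⊗ b + a' ⊗ b.
Proof. by have /= := (pure_bilin A B).1 b 1 a a'; rewrite !scale1r. Qed.
Lemma tpureDr (a : A) (b b' : B) : a ⊗ (b + b') = a ⊗ b + a ⊗ b'.
Proof. by have /= := (pure_bilin A B).2 a 1 b b'; rewrite !scale1r. Qed.
Lemma tpureZl c (a : A) (b : B) : (c *: a) ⊗ b = c *: (a ⊗ b).
Proof. exact: (scalable_linear ((pure_bilin A B).1 b)). Qed.
Lemma tpureZr c (a : A) (b : B) : a ⊗ (c *: b) = c *: (a ⊗ b).
Proof. exact: (scalable_linear ((pure_bilin A B).2 a)). Qed.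

Definition tens_mul (x y : T) : T :=
  tlift (fun a b => tlift (fun c d => (a * c) ⊗ (b * d)) y) x.

Fact mul_bilin2 (a : A) (b : B) : bilin (fun c d => (a * c) ⊗ (b * d) : T).
Proof.
split=> [d k c c'|c k d d'].
- by rewrite mulrDr tpureDl -scalerAr tpureZl.
- by rewrite mulrDr tpureDr -scalerAr tpureZr.
Qed.

Fact tlift_fun (V : lmodType C) (k : C) (f g : A -> B -> V) (x : T) :
  tlift (fun a b => k *: f a b + g a b) x = k *: tlift f x + tlift g x.
Proof.
by rewrite /tlift /tens_sum big_split scaler_sumr.
Qed.

Fact mul_bilin1 (y : T) :
  bilin (fun a b => tlift (fun c d => (a * c) ⊗ (b * d) : T) y).
Proof.
split=> [b k a a'|a k b b']; rewrite -tlift_fun; apply: eq_bigr => -[c d] _ /=.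
- by rewrite mulrDl tpureDl -scalerAl tpureZl.
- by rewrite mulrDl tpureDr -scalerAl tpureZr.
Qed.

Lemma tens_mul_pure a b c d : tens_mul (a ⊗ b) (c ⊗ d) = (a * c) ⊗ (b * d).
Proof.
rewrite /tens_mul tlift_pure; last exact: mul_bilin1.
by rewrite tlift_pure//; exact: mul_bilin2.
Qed.

Fact tens_mul_linl y : linear (tens_mul^~ y).
Proof. exact/tlift_linear/mul_bilin1. Qed.
Fact tens_mul_linr x : linear (tens_mul x).
Proof.
move=> k y y'; rewrite -tlift_fun; apply: eq_bigr => -[a b] _ /=.
exact/tlift_linear/mul_bilin2.
Qed.

Fact tens_mulDl : left_distributive tens_mul +%R.
Proof. by move=> x y z; have := tens_mul_linl z 1 x y; rewrite !scale1r. Qed.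
Fact tens_mulDr : right_distributive tens_mul +%R.
Proof. by move=> x y z; have := tens_mul_linr x 1 y z; rewrite !scale1r. Qed.
Fact tens_mul0l y : tens_mul 0 y = 0.
Proof. by apply: (addIr (tens_mul 0 y)); rewrite -tens_mulDl !add0r. Qed.
Fact tens_mul0r x : tens_mul x 0 = 0.
Proof. by apply: (addIr (tens_mul x 0)); rewrite -tens_mulDr !add0r. Qed.

Fact tens_mulA : associative tens_mul.
Proof.
elim/tens_ind => [a b||x x' IH IH'] y z; last 2 first.
- by rewrite !tens_mul0l.
- by rewrite !tens_mulDl IH IH'.
elim/tens_ind: y => [c d||y y' IH IH']; last 2 first.
- by rewrite !(tens_mul0l, tens_mul0r).
- by rewrite !(tens_mulDl, tens_mulDr) IH IH'.
elim/tens_ind: z => [e f||z z' IH IH']; last 2 first.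
- by rewrite !tens_mul0r.
- by rewrite !tens_mulDr IH IH'.
by rewrite !tens_mul_pure !mulrA.
Qed.

Fact tens_mul1l : left_id (1 ⊗ 1) tens_mul.
Proof.
elim/tens_ind => [a b||x y IH IH']; rewrite ?tens_mul0r// ?tens_mulDr ?IH ?IH'//.
by rewrite tens_mul_pure !mul1r.
Qed.
Fact tens_mul1r : right_id (1 ⊗ 1) tens_mul.
Proof.
elim/tens_ind => [a b||x y IH IH']; rewrite ?tens_mul0l// ?tens_mulDl ?IH ?IH'//.
by rewrite tens_mul_pure !mulr1.
Qed.

Definition tens_tau : T -> C := @tlift C A B C^o (fun a b => tau a * tau b).

Fact tau_bilin : @bilin C A B C^o (fun a b => tau a * tau b).
Proof.
split=> [b k a a'|a k b b']; rewrite linearP/=.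
- by rewrite mulrDl -mulrA.
- by rewrite mulrDr mulrCA.
Qed.

Lemma tens_tau_pure a b : tens_tau (a ⊗ b) = tau a * tau b.
Proof. by rewrite /tens_tau tlift_pure//; exact: tau_bilin. Qed.

Fact tens_tau_linear : linear_for *%R tens_tau.
Proof. by move=> k x y; exact: (tlift_linear tau_bilin k x y). Qed.

Fact tens_tau1 : tens_tau (1 ⊗ 1) = 1.
Proof. by rewrite tens_tau_pure !tau1 mulr1. Qed.

Fact tens_tau0 : tens_tau 0 = 0.
Proof.
by have := tens_tau_linear (-1) 0 0; rewrite scaler0 addr0 mulN1r addNr.
Qed.

Fact tens_tauD : {morph tens_tau : x y / x + y}.
Proof.
by move=> x y; have := tens_tau_linear 1 x y; rewrite scale1r mul1r.
Qed.

Fact tens_oner_neq0 : 1 ⊗ 1 != 0 :> T.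
Proof.
apply/eqP => /(congr1 tens_tau)/eqP.
by rewrite tens_tau1 tens_tau0 oner_eq0.
Qed.

HB.instance Definition _ := GRing.Zmodule_isNzRing.Build T
  tens_mulA tens_mul1l tens_mul1r tens_mulDl tens_mulDr tens_oner_neq0.

Lemma tens_mulE (a c : A) (b d : B) : (a ⊗ b) * (c ⊗ d) = (a * c) ⊗ (b * d).
Proof. exact: tens_mul_pure. Qed.

Fact tens_scalerAl (k : C) (x y : T) : k *: (x * y) = (k *: x) * y.
Proof. by have := tens_mul_linl y k x 0; rewrite !addr0 tens_mul0l addr0. Qed.
HB.instance Definition _ := GRing.Lmodule_isLalgebra.Build C T tens_scalerAl.

Fact tens_scalerAr (k : C) (x y : T) : k *: (x * y) = x * (k *: y).
Proof. by have := tens_mul_linr x k y 0; rewrite !addr0 tens_mul0r addr0. Qed.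
HB.instance Definition _ := GRing.Lalgebra_isAlgebra.Build C T tens_scalerAr.

Definition tens_star (x : T) : T :=
  @tlift C A B (conjmod T) (fun a b => star a ⊗ star b) x.

Fact star_bilin : @bilin C A B (conjmod T) (fun a b => star a ⊗ star b).
Proof.
split=> [b k a a'|a k b b'].
- by rewrite starD starZ tpureDl tpureZl.
- by rewrite starD starZ tpureDr tpureZr.
Qed.

Lemma tens_star_pure a b : tens_star (a ⊗ b) = star a ⊗ star b.
Proof. by rewrite /tens_star tlift_pure//; exact: star_bilin. Qed.

Fact tens_star_linear k x y : tens_star (k *: x + y) = k^* *: tens_star x + tens_star y.
Proof. exact: (tlift_linear star_bilin k x y). Qed.
Fact tens_starD : {morph tens_star : x y / x + y}.
Proof.
by move=> x y; have := tens_star_linear 1 x y; rewrite rmorph1 !scale1r.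
Qed.
Fact tens_star0 : tens_star 0 = 0.
Proof. by apply: (addIr (tens_star 0)); rewrite -tens_starD !add0r. Qed.
Fact tens_starZ (c : C) x : tens_star (c *: x) = c^* *: tens_star x.
Proof. by have := tens_star_linear c x 0; rewrite addr0 tens_star0 addr0. Qed.
Fact tens_starK : involutive tens_star.
Proof.
elim/tens_ind => [a b||x y IH IH'].
- by rewrite !tens_star_pure !starK.
- by rewrite !tens_star0.
- by rewrite !tens_starD IH IH'.
Qed.
Fact tens_starM (x y : T) : tens_star (x * y) = tens_star y * tens_star x.
Proof.
elim/tens_ind: x => [a b||x x' IH IH']; last 2 first.
- by rewrite mul0r tens_star0 mulr0.
- by rewrite mulrDl !tens_starD mulrDr IH IH'.
elim/tens_ind: y => [c d||y y' IH IH']; last 2 first.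
- by rewrite mulr0 tens_star0 mul0r.
- by rewrite mulrDr !tens_starD mulrDl IH IH'.
by rewrite tens_mulE !tens_star_pure tens_mulE !starM.
Qed.

HB.instance Definition _ := Algebra_isStarAlgebra.Build C T
  tens_starK tens_starD tens_starZ tens_starM.

Lemma tens_starE (a : A) (b : B) : star (a ⊗ b : T) = star a ⊗ star b.
Proof. exact: tens_star_pure. Qed.

Fact tens_tau_trace (x y : T) : tens_tau (x * y) = tens_tau (y * x).
Proof.
elim/tens_ind: x => [a b||x x' IH IH']; last 2 first.
- by rewrite mul0r mulr0.
- by rewrite mulrDl mulrDr !tens_tauD IH IH'.
elim/tens_ind: y => [c d||y y' IH IH']; last 2 first.
- by rewrite mul0r mulr0.
- by rewrite mulrDl mulrDr !tens_tauD IH IH'.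
by rewrite !tens_mulE !tens_tau_pure (tau_trace a) (tau_trace b).
Qed.

(* orthogonalizing the left factors gives positivity and faithfulness *)
Lemma tens_orth (x : T) : exists n (e : 'I_n -> A) (b : 'I_n -> B),
  x = \sum_i e i ⊗ b i /\ (forall i j, i != j -> tau (star (e i) * e j) = 0).
Proof.
elim/tens_seq_ind: x => [|a b _ [n [e [f [-> eo]]]]].
  exists 0, (fun=> 0), (fun=> 0); split; first by rewrite big_ord0.
  by case.
pose c i := tau (star (e i) * a) / tau (star (e i) * e i).
pose a' := a - \sum_i c i *: e i.
have ea' i : tau (star (e i) * a') = 0.
  rewrite /a' mulrBr raddfB/= mulr_sumr raddf_sum/= (bigD1 i)//= big1 ?addr0.
    rewrite -scalerAr linearZ/= /c.
    have [e0|e0] := eqVneq (tau (star (e i) * e i)) 0.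
      by rewrite e0 mulr0 subr0 (tau_faithful _ e0) star0 mul0r raddf0.
    by rewrite divfK// subrr.
  by move=> j ji; rewrite -scalerAr linearZ/= eo 1?eq_sym// mulr0.
have a'e i : tau (star a' * e i) = 0.
  by rewrite -[e i]starK -starM tau_star ea' rmorph0.
exists n.+1, (fun i => if unlift ord0 i is Some j then e j else a'),
  (fun i => if unlift ord0 i is Some j then f j + c j *: b else b); split.
  rewrite big_ord_recl/= unlift_none.
  under [X in _ = _ + X]eq_bigr do rewrite liftK tpureDr tpureZr -tpureZl.
  rewrite big_split/= addrCA addrC; congr (_ + _).
  have pD : {morph (fun y : A => y ⊗ b) : u v / u + v >-> u + v}.
    by move=> u v; exact: tpureDl.
  have p0 : (0 : A) ⊗ b = 0 by rewrite -(scale0r 0) tpureZl scale0r.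
  by rewrite -(big_morph _ pD p0) -tpureDl subrK.
move=> i j.
case: (unliftP ord0 i) => [i' ->|->]; case: (unliftP ord0 j) => [j' ->|->] //.
by rewrite (inj_eq lift_inj) => /eo.
Qed.

Lemma tens_tau_orth n (e : 'I_n -> A) (b : 'I_n -> B) :
  (forall i j, i != j -> tau (star (e i) * e j) = 0) ->
  let x : T := \sum_i e i ⊗ b i in
  tens_tau (star x * x) =
    \sum_i tau (star (e i) * e i) * tau (star (b i) * b i).
Proof.
move=> eo /=.
rewrite (big_morph _ (@starD _ T) (star0 T)) mulr_suml.
rewrite (big_morph _ tens_tauD tens_tau0); apply: eq_bigr => i _.
rewrite mulr_sumr (big_morph _ tens_tauD tens_tau0) (bigD1 i)//= big1 ?addr0.
  by rewrite tens_starE tens_mulE tens_tau_pure.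
move=> j ji.
by rewrite tens_starE tens_mulE tens_tau_pure eo 1?eq_sym// mul0r.
Qed.

Fact tens_tau_ge0 (x : T) : 0 <= tens_tau (star x * x).
Proof.
have [n [e [b [-> eo]]]] := tens_orth x.
rewrite tens_tau_orth//; apply: sumr_ge0 => i _.
by rewrite mulr_ge0 ?tau_ge0.
Qed.

Fact tens_tau_faithful (x : T) : tens_tau (star x * x) = 0 -> x = 0.
Proof.
have [n [e [b [-> eo]]]] := tens_orth x.
rewrite tens_tau_orth// => /eqP; rewrite psumr_eq0; last first.
  by move=> i _; rewrite mulr_ge0 ?tau_ge0.
move=> /allP h; apply: big1 => i _.
have := h i (mem_index_enum i); rewrite mulf_eq0.
case/orP => /eqP/tau_faithful ->.
- by rewrite -(scale0r 0) tpureZl scale0r.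
- by rewrite -(scale0r 0) tpureZr scale0r.
Qed.

HB.instance Definition _ := StarAlgebra_isNCProbSpace.Build C T
  tens_tau_linear tens_tau1 tens_tau_ge0 tens_tau_faithful tens_tau_trace.

Lemma tauE a b : tau (a ⊗ b : T) = tau a * tau b.
Proof. exact: tens_tau_pure. Qed.
End TensorAlgebra.

Section Semicircle.
Variable R : realType.
Local Notation mu := lebesgue_measure.

Definition semicircle_pdf (x : R) : R :=
  (2 * pi)^-1 * Num.sqrt (4 - x ^+ 2) * \1_[set x | `|x| <= 2] x.

Lemma semicircle_pdf_ge0 x : 0 <= semicircle_pdf x.
Proof.
by rewrite /semicircle_pdf !mulr_ge0// ?invr_ge0 ?mulr_ge0 ?pi_ge0.
Qed.

Lemma measurable_semicircle_pdf : measurable_fun [set: R] semicircle_pdf.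
Proof.
apply: measurable_funM; first apply: measurable_funM => //.
- apply: (@measurableT_comp _ _ _ _ _ _ (@Num.sqrt R)).
    by apply: continuous_measurable_fun; exact: sqrt_continuous.
  by apply: measurable_funB => //; exact: measurable_funX.
- apply: measurable_indic.
  have -> : [set x : R | `|x| <= 2] = `[-2, 2]%classic.
    by apply/seteqP; split => x /=; rewrite in_itv/= ler_norml.
  exact: measurable_itv.
Qed.

Lemma integral_semicircle_pdf : (\int[mu]_x (semicircle_pdf x)%:E = 1)%E.
Proof.
have I2 : [set x : R | `|x| <= 2] = `[-2, 2]%classic.
  by apply/seteqP; split => x /=; rewrite in_itv/= ler_norml.
pose g (x : R) : R := (2 * pi)^-1 * Num.sqrt (4 - x ^+ 2).
transitivity (\int[mu]_(x in `[(-2)%R, 2%R]) (g x)%:E)%E.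
  rewrite [RHS]integral_mkcond; apply: eq_integral => x _.
  by rewrite patchE /semicircle_pdf I2 indicE; case: ifPn => _; rewrite ?mulr1 ?mulr0.
have pi0 : 0 < pi :> R by exact: pi_gt0.
have pn0 : pi != 0 :> R by rewrite gt_eqF.
pose F (t : R) : R := 2 * sin t.
have dF (t : R) : is_derive t (1 : R) F (2 * cos t).
  by rewrite /F; apply: is_derive_eq.
have F1 : derive1 F = (fun t => 2 * cos t).
  by apply/funext => t; rewrite derive1E; exact: derive_val.
have Fa : F (- (pi / 2)) = -2 by rewrite /F sinN sin_pihalf mulrN1.
have Fb : F (pi / 2) = 2 by rewrite /F sin_pihalf mulr1.
have cF1 : continuous (derive1 F).
  rewrite F1 => t; apply: cvgM; first exact: cvg_cst.
  exact: continuous_cos.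
have cF : continuous F.
  by move=> t; apply/differentiable_continuous/derivable1_diffP; case: (dF t).
have ab : - (pi / 2) <= pi / 2 :> R by rewrite lerNl -subr_ge0; lra.
have ab' : - (pi / 2) < pi / 2 :> R by lra.
rewrite -Fa -[in X in `[_, X]]Fb.
rewrite integration_by_substitution_increasing//; first last.
- apply: continuous_subspaceT => x; apply: cvgM; first exact: cvg_cst.
  apply: (@continuous_comp _ _ _ (fun x : R => 4 - x ^+ 2)); last exact: sqrt_continuous.
  by apply: cvgB; [exact: cvg_cst|exact: exprn_continuous].
- split.
  + by move=> x _; case: (dF x).
  + exact/cvg_at_right_filter/cF.
  + exact/cvg_at_left_filter/cF.
- by apply/cvg_ex; eexists; exact/cvg_at_left_filter/cF1.
- by apply/cvg_ex; eexists; exact/cvg_at_right_filter/cF1.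
- by move=> t u tI uI; rewrite /F ltr_pM2l// ltr_sin.
pose G (t : R) : R := pi^-1 * (t + sin t * cos t).
have dG (t : R) : is_derive t (1 : R) G (2 * pi^-1 * cos t ^+ 2).
  rewrite /G; apply: is_derive_eq.
  rewrite /GRing.scale/=.
  by rewrite -!expr2 cos2sin2; ring.
have G1 : derive1 G = (fun t => 2 * pi^-1 * cos t ^+ 2).
  by apply/funext => t; rewrite derive1E; exact: derive_val.
have cG : continuous G.
  by move=> t; apply/differentiable_continuous/derivable1_diffP; case: (dG t).
transitivity (\int[mu]_(x in `[(- (pi / 2))%R, (pi / 2)%R]) (derive1 G x)%:E)%E.
  apply: eq_integral => x; rewrite inE/= in_itv/= => /andP[x1 x2].
  rewrite F1 G1 /= /g /F; congr (_%:E).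
  transitivity ((2 * pi)^-1 * Num.sqrt (4 - (2 * sin x) ^+ 2) * (2 * cos x)) => //.
  have -> : 4 - (2 * sin x) ^+ 2 = (2 * cos x) ^+ 2 :> R.
    by rewrite !exprMn cos2sin2; ring.
  rewrite sqrtr_sqr ger0_norm; last by rewrite mulr_ge0// cos_ge0_pihalf// x1 x2.
  by move: pn0; move: (pi : R) => p pn0; field.
rewrite (@continuous_FTC2 _ _ G)//.
- rewrite -EFinB /G sinN cosN cos_pihalf !mulr0 !addr0; congr (_%:E).
  by move: pn0; move: (pi : R) => p pn0; field.
- rewrite G1; apply: continuous_subspaceT => x.
  apply: cvgM; first exact: cvg_cst.
  apply: (@continuous_comp _ _ _ cos (fun x => x ^+ 2)).
    exact: continuous_cos.
  exact: exprn_continuous.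
- split.
  + by move=> x _; case: (dG x).
  + exact/cvg_at_right_filter/cG.
  + exact/cvg_at_left_filter/cG.
Qed.

Definition semicircle_prob : set (measurableTypeR R) -> \bar R :=
  fun U => (\int[mu]_(x in U) (semicircle_pdf x)%:E)%E.

Fact semicircle0 : semicircle_prob set0 = 0%E.
Proof. by rewrite /semicircle_prob integral_set0. Qed.

Fact semicircle_ge0 U : (0 <= semicircle_prob U)%E.
Proof.
by apply: integral_ge0 => x _; rewrite lee_fin semicircle_pdf_ge0.
Qed.

Fact semicircle_sigma_additive : semi_sigma_additive semicircle_prob.
Proof.
move=> /= F mF tF mUF; rewrite /semicircle_prob; apply: cvg_toP.
  apply: ereal_nondecreasing_is_cvgn => m n mn.
  apply: lee_sum_nneg_natr => // k _ _.
  by apply: integral_ge0 => /= x _; rewrite lee_fin semicircle_pdf_ge0.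
rewrite ge0_integral_bigcup//=.
- apply: measurable_funTS; apply: measurableT_comp => //.
  exact: measurable_semicircle_pdf.
- by move=> x _; rewrite lee_fin semicircle_pdf_ge0.
Qed.

HB.instance Definition _ := isMeasure.Build _ _ _ semicircle_prob
  semicircle0 semicircle_ge0 semicircle_sigma_additive.

Fact semicircle_setT : semicircle_prob [set: _] = 1%E.
Proof. exact: integral_semicircle_pdf. Qed.

HB.instance Definition _ := @Measure_isProbability.Build _ _ R
  semicircle_prob semicircle_setT.

End Semicircle.
Arguments semicircle_prob : clear implicits.


Section FreeIndependence.
Variables (C : numClosedFieldType) (A : ncProbSpaceType C).

Definition self_adjoint (x : A) : Prop := star x = x.

Definition var (x : A) : C := tau ((x - (tau x)%:A) ^+ 2).

Definition gen_subalg (X : set A) : set A :=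
  smallest [set S : set A | GRing.subalg_closed (mem S)] X.

Definition free_subalgebras (I : Type) (S : I -> set A) : Prop :=
  forall (m : nat) (j : 'I_m -> I) (x : 'I_m -> A), (0 < m)%N ->
    (forall i, S (j i) (x i)) ->
    (forall i, tau (x i) = 0) ->
    (forall i i' : 'I_m, i' = i.+1 :> nat -> j i <> j i') ->
  tau (\prod_(i < m) x i) = 0.

Definition free_family (I : Type) (x : I -> A) : Prop :=
  free_subalgebras (fun i => gen_subalg [set x i]).

Definition free_copies (a : A) (a_ : nat -> A) : Prop :=
  [/\ forall k, self_adjoint (a_ k), free_family a_ &
      forall k m, tau (a_ k ^+ m) = tau (a ^+ m)].

End FreeIndependence.

Section Laws.
Variable R : realType.
Local Notation law := (probability (measurableTypeR R) R).

Definition moment (mu : law) (m : nat) : R := \int[mu]_x (x ^+ m).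

Definition compactly_supported (mu : law) : Prop :=
  exists2 K : set R, compact K & mu (~` K) = 0%E.

Definition scale_fun (t : R) : measurableTypeR R -> measurableTypeR R :=
  fun x => t * x.

Fact measurable_scale_fun t : measurable_fun [set: _] (scale_fun t).
Proof. exact: measurable_funM. Qed.

HB.instance Definition _ t :=
  isMeasurableFun.Build _ _ _ _ (scale_fun t) (measurable_scale_fun t).

(* for t = 0 this is the Dirac mass at 0 *)
Definition dilation (t : R) (mu : law) : law := distribution mu (scale_fun t).

Definition add_fun2 (z : measurableTypeR R * measurableTypeR R) :
  measurableTypeR R := z.1 + z.2.

Fact measurable_add_fun2 : measurable_fun [set: _] add_fun2.
Proof. exact: measurable_funD. Qed.

HB.instance Definition _ :=
  isMeasurableFun.Build _ _ _ _ add_fun2 measurable_add_fun2.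

Definition classical_conv (mu nu : law) : law :=
  distribution (mu \x nu)%E add_fun2.

Definition has_law (A : ncProbSpaceType R[i]) (x : A) (mu : law) : Prop :=
  compactly_supported mu /\ forall m, tau (x ^+ m) = (moment mu m)%:C%C.

(* rho is the free convolution of mu and nu.  The compactly supported measure *)
(* rho is determined by mu and nu: freeness fixes the moments of x + y.       *)
Definition is_free_conv (mu nu rho : law) : Prop :=
  exists (A : ncProbSpaceType R[i]) (x y : A),
    [/\ self_adjoint x /\ self_adjoint y,
        free_family (fun b : bool => if b then x else y),
        has_law x mu, has_law y nu & has_law (x + y) rho].

Definition cvg_in_distribution (A : ncProbSpaceType R[i]) (S : nat -> A)
    (mu : law) : Prop :=
  forall m, tau (S n ^+ m) @[n --> \oo] --> ((moment mu m)%:C%C : R[i]^o).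

End Laws.

(* Main.v *)
(* Writing [a_k = lambda + s b_k] with [b_k] standardised, [S_n] splits as
   [X_n + Y_n] where [X_n] is the normalised sum of the
   [sqrt (q / 2) (b_k ⊗ 1 + 1 ⊗ b_k)] and [Y_n] that of the
   [sqrt (1 - q) b_k ⊗ b_k].  For every word [w] in [X_n] and [Y_n],
     tau (Y_n w) = (1 - q) sum_{w = u Y_n v} tau u tau v + O(n^-1/2):
   if the index of the leading letter occurs exactly once more, freeness
   factorises the trace in both legs of the tensor product, and it vanishes
   when the other letter is an [X_n]; other indices contribute [0] or are
   negligible in number.  In the limit space, free [x] and [y] with [y]
   semicircular of variance [1 - q] satisfy the same equation exactly, which
   one sees by expanding along the Chebyshev polynomials of [y].  Traciality
   and induction on length then reduce all mixed moments to those of [X_n],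
   i.e. to the free central limit theorem for [n^-1/2 (b_1 + ... + b_n)],
   which is the same argument in a single letter, together with the Catalan
   recursion for the semicircle moments. *)
From HB Require Import structures.
Require Import Defs.
From mathcomp Require Import all_boot all_order all_algebra.
From mathcomp Require Import all_classical all_reals all_analysis.
From mathcomp Require Import complex measurable_realfun.
From mathcomp Require Import ring lra.

Set Implicit Arguments.
Unset Strict Implicit.
Unset Printing Implicit Defensive.

Import Order.TTheory GRing.Theory Num.Theory.
Import numFieldNormedType.Exports.
Local Open Scope classical_set_scope.
Local Open Scope complex_scope.
Local Open Scope ring_scope.

(** * Index tuples *)

Section Tuples.

Definition tuples (n m : nat) : seq (seq nat) :=
  iter m (fun ts => [seq j :: s | j <- index_iota 0 n, s <- ts]) [:: [::]].

#[global] Arguments tuples : simpl never.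

Lemma mem_tuples n m s : (s \in tuples n m) = (size s == m) && all (gtn n) s.
Proof.
elim: m s => [|m IH] [|j s] //=.
  by apply/negbTE/negP => /allpairsP[[? ?] []].
rewrite eqSS; apply/allpairsP/andP => [[[i t] /= [ii tm [-> ->]]]|[sm /andP[jn sn]]].
  by move: ii tm; rewrite mem_index_iota IH => /= -> /andP[-> ->].
by exists (j, s); split; rewrite //= ?IH ?sm ?sn// mem_index_iota.
Qed.

Lemma uniq_tuples n m : uniq (tuples n m).
Proof.
elim: m => // m IH; apply: allpairs_uniq => //; first exact: iota_uniq.
by move=> [i s] [j t] _ _ /= [-> ->].
Qed.

Lemma size_tuples n m : size (tuples n m) = (n ^ m)%N.
Proof.
by elim: m => // m IH; rewrite [LHS]size_allpairs IH size_iota subn0 expnS. Qed.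

Lemma big_tuplesS (V : nmodType) n m (F : seq nat -> V) :
  \sum_(k <- tuples n m.+1) F k =
  \sum_(0 <= j < n) \sum_(k <- tuples n m) F (j :: k).
Proof. exact: big_allpairs_dep. Qed.

Lemma big_tuples_cat (V : nmodType) n m p (F : seq nat -> V) :
  \sum_(k <- tuples n (m + p)) F k =
  \sum_(u <- tuples n m) \sum_(v <- tuples n p) F (u ++ v).
Proof.
elim: m F => [|m IH] F; first by rewrite add0n big_seq1.
by rewrite addSn !big_tuplesS; apply: eq_bigr => j _; rewrite IH.
Qed.

(** The tuples that neither the singleton rule nor the pair rule settles. The default in [head] is
    harmless: the empty tuple fails the second test. *)
Definition heavy (k : seq nat) : bool :=
  all (fun j => 1 < count_mem j k)%N k && (2 < count_mem (head 0%N k) k)%N.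

(** Each value in [k] uses up at least two positions and the leading one a third, whence the strict
    inequality. *)
Lemma size_undup_heavy k : heavy k -> ((size (undup k)).*2 < size k)%N.
Proof.
case: k => [|h k] //; set s := h :: k => /andP[/allP s2 h3].
have sizeE : size s = \sum_(j <- undup s) count_mem j s.
  rewrite -sum1_size -big_undup_iterop_count; apply: eq_bigr => j _.
  by rewrite Monoid.iteropE; elim: (count_mem j s) => //= c ->.
rewrite sizeE (bigD1_seq h) ?undup_uniq ?mem_undup ?mem_head//=.
have -> : (size (undup s)).*2 = (2 + \sum_(j <- undup s | j != h) 2)%N.
  rewrite -muln2 -sum1_size (bigD1_seq h) ?undup_uniq ?mem_undup ?mem_head//=.
  by rewrite mulnDl mul1n big_distrl/=.
rewrite -addSn leq_add// big_seq_cond [leqRHS]big_seq_cond.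
by apply: leq_sum => j /andP[]; rewrite mem_undup => /s2.
Qed.

(** A heavy tuple of length [m.+1] has at most [m./2] distinct values, so it is recovered from a
    list of [m./2] values and [m.+1] positions in that list. *)
Lemma count_heavy_tuples n m :
  (count heavy (tuples n m.+1) <= n ^ m./2 * m./2 ^ m.+1)%N.
Proof.
rewrite -size_filter -2!size_tuples.
rewrite -(size_allpairs (fun v g => map (nth 0%N v) g)).
apply: uniq_leq_size; first exact/filter_uniq/uniq_tuples.
move=> k; rewrite mem_filter mem_tuples => /andP[hk /andP[/eqP sk kn]].
have dk : (size (undup k) <= m./2)%N.
  by have := size_undup_heavy hk; rewrite sk ltnS => /half_leq; rewrite doubleK.
apply/allpairsP => /=.
(* Padding with the leading index gives the list its exact length and keeps its entries below
   [n]. *)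
pose v := undup k ++ nseq (m./2 - size (undup k)) (head 0%N k).
exists (v, [seq index j (undup k) | j <- k]); split => /=.
- rewrite mem_tuples /v size_cat size_nseq subnKC// eqxx/= all_cat all_nseq.
  rewrite (eq_all_r (mem_undup k)) kn /=.
  by case: (k) sk kn => //= h t _ /andP[->]; rewrite orbT.
- rewrite mem_tuples size_map sk eqxx/=; apply/allP => i /mapP[j jk ->] /=.
  by rewrite (leq_trans _ dk)// index_mem mem_undup.
- rewrite -map_comp map_id_in// => j jk /=.
  by rewrite /v nth_cat index_mem mem_undup jk nth_index// mem_undup.
Qed.

End Tuples.

(** * The asymptotic Schwinger-Dyson equation *)

Section WordSums.
Variables (C : numClosedFieldType) (A : ncProbSpaceType C) (T : eqType).
Variable c : T -> nat -> A.

Definition word (z : T -> A) (w : seq T) : A := \prod_(t <- w) z t.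

Definition monomial (w : seq T) (k : seq nat) : A :=
  \prod_(p <- zip w k) c p.1 p.2.

Lemma word_sum n (w : seq T) :
  word (fun t => \sum_(0 <= j < n) c t j) w =
  \sum_(k <- tuples n (size w)) monomial w k.
Proof.
elim: w => [|t w IH]; first by rewrite /word /monomial big_nil big_seq1 big_nil.
rewrite /word big_cons [X in _ * X]IH big_tuplesS mulr_suml.
apply: eq_bigr => j _; rewrite mulr_sumr; apply: eq_bigr => k _.
by rewrite /monomial/= big_cons.
Qed.

Lemma wordZ (z : T -> A) (r : C) (w : seq T) :
  word (fun t => r *: z t) w = r ^+ size w *: word z w.
Proof.
elim: w => [|t w IH]; first by rewrite /word !big_nil expr0 scale1r.
by rewrite /word !big_cons [X in _ * X]IH -scalerAl -scalerAr scalerA exprS.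
Qed.

Lemma word_cat (z : T -> A) (u v : seq T) : word z (u ++ v) = word z u * word z v.
Proof. by rewrite /word big_cat. Qed.

End WordSums.

Section CentralLimit.
Variables (C : numClosedFieldType) (A : ncProbSpaceType C) (T : eqType).
Variables (c : T -> nat -> A) (y : T) (kappa : T -> C) (bd : seq T -> C).
Local Notation phi w k := (tau (monomial c w k)).

Hypothesis phi_bound : forall w k, size k = size w -> `|phi w k| <= bd w.
Hypothesis phi_singleton : forall w k j, size k = size w ->
  count_mem j k = 1%N -> phi w k = 0.
Hypothesis phi_pair : forall w k p, size k = size w -> (p < size w)%N ->
  nth 0%N k p \notin take p k -> nth 0%N k p \notin drop p.+1 k ->
  phi (y :: w) (nth 0%N k p :: k) =
  kappa (nth y w p) * (phi (take p w) (take p k) * phi (drop p.+1 w) (drop p.+1 k)).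

Definition clt_sum (n : nat) (t : T) : A :=
  (sqrtC n%:R)^-1 *: \sum_(0 <= j < n) c t j.

(** For [F] a trace this is [F ⊗ F] applied to the free difference quotients of [w], weighted by the
    covariances [kappa] of the leading letter [y] with the others. *)
Definition split_sum (F : seq T -> C) (w : seq T) : C :=
  \sum_(p < size w) kappa (nth y w p) * (F (take p w) * F (drop p.+1 w)).

(** The indicator lets [p] range over all positions for every [k], so that the sums over [k] and [p]
    can be exchanged. *)
Let pair_term (w : seq T) (k : seq nat) : C := \sum_(p < size w)
  kappa (nth y w p) * ((nth 0%N (behead k) p == head 0%N k)%:R *
   (phi (take p w) (take p (behead k)) * phi (drop p.+1 w) (drop p.+1 (behead k)))).

Let size_takeE (w : seq T) (k : seq nat) p : size k = size w ->
  size (take p k) = size (take p w).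
Proof. by move=> h; rewrite !size_take h. Qed.

Let size_dropE (w : seq T) (k : seq nat) p : size k = size w ->
  size (drop p k) = size (drop p w).
Proof. by move=> h; rewrite !size_drop h. Qed.

Let count_split (k : seq nat) p j : (p < size k)%N ->
  count_mem j k = (count_mem j (take p k) + (nth 0 k p == j) + count_mem j (drop p.+1 k))%N.
Proof.
move=> pk; rewrite -{1}(cat_take_drop p k) (drop_nth 0%N pk) count_cat /=.
by rewrite addnA.
Qed.

(** If some index occurs once, both sides vanish; otherwise the leading index occurs exactly twice,
    and its second position is the only [p] that contributes. *)
Let phi_pair_term (w : seq T) (k : seq nat) : size k = (size w).+1 ->
  ~~ heavy k -> phi (y :: w) k = pair_term w k.
Proof.
case: k => // h k [sk]; rewrite /heavy negb_and -leqNgt /pair_term.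
have pk (p : 'I_(size w)) : (p < size k)%N by rewrite sk.
case: (boolP (all _ (h :: k))) => [/allP aj|/allPn[j jk]]; last first.
  rewrite -leqNgt => cj _.
  have {}cj : count_mem j (h :: k) = 1%N.
    by apply/eqP; rewrite eqn_leq cj -has_count has_pred1.
  rewrite (phi_singleton (j := j))//=; last by rewrite sk.
  rewrite big1// => p _; have [hp|_] := eqVneq; last by rewrite mul0r mulr0.
  move: cj => /=; rewrite (count_split j (pk p)) hp.
  (* If [j] were [h] it would occur twice, at the front and at [p]; so it survives as a singleton in
     one of the two pieces. *)
  have [_|hj] := eqVneq h j; first by rewrite addn1 addSn addnS.
  rewrite addn0 add0n => cj.
  suff [->|->] : phi (take p w) (take p k) = 0 \/
      phi (drop p.+1 w) (drop p.+1 k) = 0 by rewrite ?mul0r !mulr0.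
  have [c0|c1] := posnP (count_mem j (take p k)).
    by right; apply: (phi_singleton (j := j)); [exact: size_dropE|move: cj; rewrite c0].
  left; apply: (phi_singleton (j := j)); first exact: size_takeE.
  by move: cj c1; case: count => // -[|].
rewrite [head _ _]/= [count_mem _ _]/= eqxx add1n /= => ch.
have {ch}ch : count_mem h k = 1%N.
  apply/eqP; rewrite eqn_leq -ltnS ch /=.
  by have := aj h (mem_head _ _); rewrite /= eqxx add1n ltnS.
have hk : h \in k by rewrite -has_pred1 has_count ch.
have pw : (index h k < size w)%N by rewrite -sk index_mem.
have hE : nth 0%N k (index h k) = h by rewrite nth_index.
have hpw : (index h k < size k)%N by rewrite index_mem.
have := ch; rewrite (count_split h hpw) hE eqxx => /eqP.
rewrite addn1 addSn eqSS addn_eq0 => /andP[/eqP ct /eqP cd].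
rewrite (bigD1 (Ordinal pw))//= hE eqxx mul1r -{1}hE phi_pair ?hE//; first last.
- by rewrite -has_pred1 has_count cd.
- by rewrite -has_pred1 has_count ct.
rewrite big1 ?addr0// => p pN; have [hp|_] := eqVneq; last by rewrite mul0r mulr0.
exfalso; have := ch; rewrite (count_split h (pk p)) hp eqxx addn1 addSn => -[] /eqP.
rewrite addn_eq0 => /andP[/eqP c1 /eqP c2].
have := hk; rewrite -(cat_take_drop p k) (drop_nth 0%N (pk p)) hp.
have hN : h \notin take p k by rewrite -has_pred1 has_count c1.
move=> _; move/negP: pN; apply; apply/eqP/val_inj => /=.
by rewrite -{1}(cat_take_drop p k) (drop_nth 0%N (pk p)) hp
  index_cat (negPf hN)/= eqxx addn0 size_take pk.
Qed.

(** Once [p] is chosen, the common value of the paired indices has [n] choices, and the indices on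
    either side of [p] are summed independently. *)
Let sum_pair_term n (w : seq T) :
  \sum_(k <- tuples n (size w).+1) pair_term w k =
  n%:R * split_sum (fun u => \sum_(k <- tuples n (size u)) phi u k) w.
Proof.
rewrite /pair_term exchange_big/= /split_sum mulr_sumr; apply: eq_bigr => p _.
rewrite -mulr_sumr mulrCA; congr (_ * _).
case: p => p pw /=.
have -> : size w = (size (take p w) + (size (drop p.+1 w)).+1)%N.
  by rewrite size_take pw size_drop subnSK// subnKC// ltnW.
have sp : size (take p w) = p by rewrite size_take pw.
rewrite big_tuplesS.
transitivity (\sum_(0 <= h < n) ((\sum_(k <- tuples n (size (take p w))) phi (take p w) k) *
   (\sum_(k <- tuples n (size (drop p.+1 w))) phi (drop p.+1 w) k))); last first.
  by rewrite sumr_const_nat subn0 mulr_natl.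
apply: eq_big_nat => h /andP[_ hn]; rewrite big_tuples_cat mulr_suml.
apply: eq_big_seq => u; rewrite mem_tuples sp => /andP[/eqP su _].
rewrite big_tuplesS mulr_sumr (bigD1_seq h) ?mem_index_iota ?iota_uniq//= [X in _ + X]big1.
  rewrite addr0; apply: eq_bigr => v _.
  rewrite nth_cat su ltnn subnn/= eqxx mul1r take_size_cat//.
  by rewrite -cat_rcons drop_size_cat// size_rcons su.
move=> j jh; rewrite big1// => v _.
by rewrite nth_cat su ltnn subnn/= (negPf jh) mul0r.
Qed.

Let bd_pair (w : seq T) : C := bd (y :: w) +
  \sum_(p < size w) `|kappa (nth y w p)| * (bd (take p w) * bd (drop p.+1 w)).

Let phi_pair_bound (w : seq T) (k : seq nat) : size k = (size w).+1 ->
  `|phi (y :: w) k - pair_term w k| <= bd_pair w.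
Proof.
case: k => // h k [sk]; apply: (le_trans (ler_normB _ _)); apply: lerD.
  by apply: phi_bound; rewrite /= sk.
apply: (le_trans (ler_norm_sum _ _ _)); apply: ler_sum => p _.
rewrite normrM ler_wpM2l// normrM.
have b1 := phi_bound (size_takeE p sk); have b2 := phi_bound (size_dropE p.+1 sk).
apply: (@le_trans _ _ (1 * `|phi (take p w) (take p k) * phi (drop p.+1 w) (drop p.+1 k)|)).
  by apply: ler_wpM2r => //; case: eqVneq; rewrite ?normr1 ?normr0.
by rewrite mul1r normrM ler_pM.
Qed.

(* Index tuples with a singleton do not contribute, and those without
   singletons in which the leading index occurs at least three times number
   only [O(n^(m/2))], against a normalisation by [n^((m+1)/2)]. *)
Lemma clt_schwinger_dyson (w : seq T) : exists2 K : C, 0 <= K &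
  forall n, (0 < n)%N ->
  `|tau (word (clt_sum n) (y :: w)) -
    split_sum (fun u => tau (word (clt_sum n) u)) w| <= K / sqrtC n%:R.
Proof.
set m := size w.
pose N : C := (m./2 ^ m.+1)%:R.
have bd0 u : 0 <= bd u.
  by apply: le_trans (phi_bound (size_nseq (size u) 0%N)).
have bdp0 : 0 <= bd_pair w.
  apply: addr_ge0 => //; apply: sumr_ge0 => p _.
  by rewrite mulr_ge0// mulr_ge0.
exists (bd_pair w * N) => [|n n0]; first by rewrite mulr_ge0 ?ler0n.
set r := sqrtC n%:R.
have r0 : 0 < r by rewrite sqrtC_gt0 ltr0n.
have rN : r != 0 by rewrite gt_eqF.
have r1 : 1 <= r by rewrite -[1]sqrtC1 ler_sqrtC ?qualifE/= ?ler0n ?ler01// ler1n.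
have r2 : n%:R = r ^+ 2 by rewrite sqrtCK.
have wE u : tau (word (clt_sum n) u) = r^-1 ^+ size u * \sum_(k <- tuples n (size u)) phi u k.
  by rewrite /clt_sum wordZ linearZ/= word_sum raddf_sum.
(* The factor [n%:R = r ^+ 2] cancels the normalisation of the two paired letters; the other factors
   [r^-1] are shared between the pieces of lengths [p] and [m - p.+1]. *)
have -> : split_sum (fun u => tau (word (clt_sum n) u)) w =
   r^-1 ^+ m.+1 * \sum_(k <- tuples n m.+1) pair_term w k.
  rewrite sum_pair_term mulrA /split_sum mulr_sumr; apply: eq_bigr => p _.
  rewrite !wE [RHS]mulrCA; congr (_ * _).
  rewrite mulrACA; congr (_ * _).
  rewrite -exprD size_take ltn_ord size_drop r2.
  rewrite [in RHS](_ : m.+1 = (2 + (p + (m - p.+1)))%N).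
    by rewrite [in RHS]exprD mulrAC -exprMn mulVf// expr1n mul1r.
  by have pm : (p < m)%N := ltn_ord p; rewrite -[in LHS](subnKC pm).
rewrite wE/= -mulrBr -sumrB normrM normrX normfV (ger0_norm (ltW r0)).
rewrite (bigID heavy)/= [X in _ + X]big_seq_cond [X in _ + X]big1 ?addr0; last first.
  move=> k /andP[]; rewrite mem_tuples => /andP[/eqP sk _] hk.
  by rewrite phi_pair_term// subrr.
have -> : bd_pair w * N / r = r^-1 ^+ m.+1 * (r ^+ m * (bd_pair w * N)).
  by rewrite exprSr -!mulrA (mulrCA r^-1) !mulrA -exprMn mulVf// expr1n mul1r mulrC mulrA.
apply: ler_wpM2l; first by rewrite exprn_ge0// invr_ge0 ltW.
apply: (le_trans (ler_norm_sum _ _ _)).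
apply: (@le_trans _ _ (\sum_(k <- tuples n m.+1 | heavy k) bd_pair w)).
  rewrite big_seq_cond [leRHS]big_seq_cond; apply: ler_sum => k /andP[].
  by rewrite mem_tuples => /andP[/eqP sk _] _; exact: phi_pair_bound.
rewrite big_const_seq iter_addr_0 -mulr_natr mulrCA ler_wpM2l//.
apply: (@le_trans _ _ ((n ^ m./2 * m./2 ^ m.+1)%N%:R)).
  by rewrite ler_nat count_heavy_tuples.
rewrite natrM ler_wpM2r ?ler0n// natrX r2 -exprM mulnC muln2.
(* [1 <= r] absorbs the parity of [m], since [m./2 * 2 <= m]. *)
by apply: ler_weXn2l => //; rewrite -[leqRHS]odd_double_half leq_addl.
Qed.

End CentralLimit.

(** * Traces of words in free elements *)

Section GenSubalg.
Variables (C : numClosedFieldType) (A : ncProbSpaceType C) (X : set A).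

Lemma gen_subalg_sub x : X x -> gen_subalg X x.
Proof. by move=> Xx B [_]; exact. Qed.

Lemma gen_subalg1 : gen_subalg X 1.
Proof. by move=> B [[+ _ _] _]; rewrite in_setE. Qed.

Lemma gen_subalgP c x y : gen_subalg X x -> gen_subalg X y ->
  gen_subalg X (c *: x + y).
Proof.
move=> Xx Xy B BX; case: (BX) => -[_ /(_ c x y) + _] _; rewrite !in_setE.
by apply; [exact: Xx|exact: Xy].
Qed.

Lemma gen_subalgM x y : gen_subalg X x -> gen_subalg X y -> gen_subalg X (x * y).
Proof.
move=> Xx Xy B BX; case: (BX) => -[_ _ /(_ x y)] + _; rewrite !in_setE.
by apply; [exact: Xx|exact: Xy].
Qed.

Lemma gen_subalgZ c x : gen_subalg X x -> gen_subalg X (c *: x).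
Proof.
move=> Xx; have X0 : gen_subalg X 0.
  by have := gen_subalgP (-1) gen_subalg1 gen_subalg1; rewrite scaleN1r addNr.
by have := gen_subalgP c Xx X0; rewrite addr0.
Qed.

Lemma gen_subalgX x n : gen_subalg X x -> gen_subalg X (x ^+ n).
Proof.
move=> Xx; elim: n => [|n IH]; first by rewrite expr0; exact: gen_subalg1.
by rewrite exprS; exact: gen_subalgM.
Qed.

End GenSubalg.

Section Centring.
Variables (C : numClosedFieldType) (A : ncProbSpaceType C).

Definition centred_pow (a : A) (e : nat) : A := a ^+ e - (tau (a ^+ e))%:A.

Lemma tau_scalar (c : C) : tau (c%:A : A) = c.
Proof. by rewrite linearZ/= tau1 mulr1. Qed.

Lemma tau_centred_pow a e : tau (centred_pow a e) = 0.
Proof. by rewrite raddfB/= tau_scalar subrr. Qed.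

Lemma centred_pow1 a : tau a = 0 -> centred_pow a 1 = a.
Proof. by move=> a0; rewrite /centred_pow expr1 a0 scale0r subr0. Qed.

Lemma mul_centred_pow a e : a * centred_pow a e =
  centred_pow a e.+1 + (tau (a ^+ e.+1))%:A - tau (a ^+ e) *: a.
Proof. by rewrite mulrBr -exprS -scalerAr mulr1 subrK. Qed.

End Centring.

Section Freeness.
Variables (C : numClosedFieldType) (A : ncProbSpaceType C) (I : eqType).
Variables (x z : I -> A).
Hypothesis x_free : free_family x.
Hypothesis zx : forall i, gen_subalg [set x i] (z i).

Local Notation neqfst := (fun p q : I * _ => p.1 != q.1).

Lemma free_alternating (l : seq (I * A)) : l != [::] -> sorted neqfst l ->
  (forall p, p \in l -> gen_subalg [set x p.1] p.2 /\ tau p.2 = 0) ->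
  tau (\prod_(p <- l) p.2) = 0.
Proof.
case: l => // p0 l _ sl hl; set l' := p0 :: l in sl hl *.
rewrite (big_nth p0) big_mkord.
apply: (x_free (j := fun i => (nth p0 l' i).1)) => //.
- by move=> i; apply: (hl _ _).1; rewrite mem_nth.
- by move=> i; apply: (hl _ _).2; rewrite mem_nth.
- move=> i i' ii'; apply/eqP; rewrite ii'.
  by have /(sortedP p0) h := sl; apply: h; rewrite -ii'.
Qed.

Local Notation value s := (\prod_(p <- s) centred_pow (z p.1) p.2).

Let value_free (s : seq (I * nat)) : s != [::] -> sorted neqfst s -> tau (value s) = 0.
Proof.
move=> s0 ss; rewrite -(big_map (fun p => (p.1, centred_pow (z p.1) p.2)) predT snd).
apply: free_alternating; first by case: s s0 ss.
  by rewrite sorted_map.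
move=> _ /mapP[[i e] _ ->] /=; split; last exact: tau_centred_pow.
rewrite /centred_pow -scaleNr addrC; apply: gen_subalgP; first exact: gen_subalg1.
exact: gen_subalgX.
Qed.

(** Both sides are linear, and the last letter of [u] is moved into [s], where it merges with a
    first factor of the same index or becomes a new centred first factor plus a scalar. For [u]
    empty, [G] and [tau] both kill every nonempty product. *)
Lemma free_value (P : pred I) (G : A -> C) (u : seq I) (s : seq (I * nat)) :
  linear_for *%R G ->
  (forall s, s != [::] -> sorted neqfst s -> all (fun p => P p.1) s -> G (value s) = 0) ->
  all P u -> sorted neqfst s -> all (fun p => P p.1) s ->
  G (word z u * value s) = tau (word z u * value s) * G 1.
Proof.
move=> lG G0; have GD : {morph G : a b / a + b} by move=> a b; rewrite -[a]scale1r lG mul1r scale1r.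
have GZ c a : G (c *: a) = c * G a.
  have G00 : G 0 = 0 by apply: (addIr (G 0)); rewrite -GD !add0r.
  by rewrite -[c *: a]addr0 lG G00 addr0.
have wS u' i : word z (rcons u' i) = word z u' * z i by rewrite /word big_rcons.
elim/last_ind: u s => [|u i IH] s Pu ss Ps.
  rewrite /word big_nil !mul1r; case: s ss Ps => [|p s] ss Ps.
    by rewrite big_nil tau1 mul1r.
  by rewrite G0// value_free// mul0r.
move: Pu; rewrite all_rcons wS -!mulrA => /andP[Pi Pu].
have [[e [s' sE]]|hs] : (exists e s', s = (i, e) :: s') \/ sorted neqfst ((i, 1%N) :: s).
- case: s ss {Ps} => [|[j e] s'] ss; first by right.
  by have [->|ij] := eqVneq i j; [left; exists e, s'|right; rewrite /= ij].
- rewrite sE in ss Ps *; have {Ps}Ps : all (fun p => P p.1) s' by case/andP: Ps.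
  have ss1 n : sorted neqfst ((i, n) :: s') by case: (s') ss.
  have ss' := path_sorted ss.
  have Ps1 n : all (fun p => P p.1) ((i, n) :: s') by rewrite /= Pi.
  (* The bare [z i] left by [mul_centred_pow] is split into [centred_pow (z i) 1] and its trace, so
     that all products stay alternating. *)
  have -> : z i * value ((i, e) :: s') = value ((i, e.+1) :: s') +
      (tau (z i ^+ e.+1) - tau (z i ^+ e) * tau (z i)) *: value s' -
      tau (z i ^+ e) *: value ((i, 1%N) :: s').
    have c1 : centred_pow (z i) 1 = z i - (tau (z i))%:A by rewrite /centred_pow expr1.
    rewrite !big_cons/= c1 mulrA mul_centred_pow !mulrDl !mulNr -!scalerAl !mul1r.
    by rewrite scalerBl scalerBr scalerA opprB -[LHS]addrA -[RHS]addrA [X in _ = _ + X]subrKA.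
  rewrite !mulrDr !mulrN -!scalerAr !GD -!scaleNr !GZ !tauD !tauZ.
  by rewrite !IH//; ring.
- have -> : z i * value s = value ((i, 1%N) :: s) + tau (z i) *: value s.
    by rewrite big_cons /= /centred_pow expr1 mulrBl -scalerAl mul1r subrK.
  rewrite !mulrDr -!scalerAr GD GZ tauD tauZ !IH//; first by ring.
  by rewrite /= Pi.
Qed.

(* A word with letters in [P] is its trace plus a combination of nonempty
   alternating centred products with indices in [P]. *)
Lemma free_functional (P : pred I) (G : A -> C) (u : seq I) :
  linear_for *%R G ->
  (forall s, s != [::] -> sorted neqfst s -> all (fun p => P p.1) s -> G (value s) = 0) ->
  all P u -> G (word z u) = tau (word z u) * G 1.
Proof.
move=> lG G0 Pu; have := free_value lG G0 Pu (s := [::]).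
by rewrite big_nil !mulr1; exact.
Qed.

Hypothesis z_centred : forall i, tau (z i) = 0.

Let neq_head (i : I) n (s : seq (I * nat)) :
  sorted neqfst s -> all (fun p => p.1 != i) s -> sorted neqfst ((i, n) :: s).
Proof. by case: s => //= p s sp /andP[pi _]; rewrite eq_sym pi. Qed.

(** Traciality brings the letter [i] to the front. As [z i] is centred, multiplying by it and taking
    the trace kills alternating products avoiding [i], and leaves a multiple of [tau (z i)]. *)
Lemma free_singleton (u : seq I) i : count_mem i u = 1%N -> tau (word z u) = 0.
Proof.
move=> ci; have iu : i \in u by rewrite -has_pred1 has_count ci.
case/splitPr: iu ci => u1 u2; rewrite count_cat /= eqxx => c1.
have {c1}[c1 c2] : count_mem i u1 = 0%N /\ count_mem i u2 = 0%N.
  by move: c1; rewrite addnCA add1n => -[] /eqP; rewrite addn_eq0 => /andP[/eqP -> /eqP].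
rewrite word_cat tau_trace /word big_cons -mulrA -big_cat -/(word z (u2 ++ u1)).
have lG : linear_for *%R (fun a => tau (z i * a)).
  by move=> c a b; rewrite mulrDr -scalerAr tauD tauZ.
rewrite (free_functional (P := fun j => j != i) lG); first by rewrite mulr1 z_centred mulr0.
- move=> s s0 ss si; rewrite -{1}(centred_pow1 (z_centred i)).
  have -> : centred_pow (z i) 1 * value s = value ((i, 1%N) :: s) by rewrite big_cons.
  by apply: value_free => //; exact: neq_head.
- rewrite all_predC has_pred1 mem_cat negb_or.
  by rewrite -!has_pred1 !has_count c1 c2.
Qed.

(** [free_functional] is applied to [u] and then to [v]. If both are replaced by nonempty centred
    products, the whole is alternating; if only one is, the two letters [z i] meet, up to rotation,
    and freeness again gives [0]. Only the two traces survive. *)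
Lemma free_pair (u v : seq I) i : i \notin u -> i \notin v ->
  tau (z i * word z u * (z i * word z v)) =
  tau (z i ^+ 2) * (tau (word z u) * tau (word z v)).
Proof.
have avoid w : i \notin w -> all (fun j => j != i) w.
  by move=> iw; apply/allP => j; apply: contraTneq => ->.
move=> iu iv; pose P j := j != i.
have c1 := centred_pow1 (z_centred i).
have lG : linear_for *%R (fun a => tau (z i * a * (z i * word z v))).
  by move=> c a b; rewrite mulrDr -scalerAr mulrDl -scalerAl tauD tauZ.
rewrite (free_functional (P := P) lG)//; last exact: avoid.
- rewrite mulr1 mulrA -expr2.
  have lG2 : linear_for *%R (fun a => tau (z i ^+ 2 * a)).
    by move=> c a b; rewrite mulrDr -scalerAr tauD tauZ.
  rewrite (free_functional (P := P) lG2)//; last exact: avoid.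
  + by rewrite mulr1; ring.
  + move=> s s0 ss si.
    have -> : z i ^+ 2 * value s = value ((i, 2%N) :: s) + tau (z i ^+ 2) *: value s.
      by rewrite big_cons/= mulrBl -scalerAl mul1r subrK.
    by rewrite tauD tauZ !value_free ?(mulr0, addr0)//; exact: neq_head.
- move=> s s0 ss si.
  have lG2 : linear_for *%R (fun a => tau (z i * value s * (z i * a))).
    by move=> c a b; rewrite mulrDr mulrDr -!scalerAr tauD tauZ.
  rewrite (free_functional (P := P) lG2)//; last exact: avoid.
  + rewrite mulr1 tau_trace mulrA -expr2.
    have -> : z i ^+ 2 * value s = value ((i, 2%N) :: s) + tau (z i ^+ 2) *: value s.
      by rewrite big_cons/= mulrBl -scalerAl mul1r subrK.
    by rewrite tauD tauZ !value_free ?(mulr0, addr0)//; exact: neq_head.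
  + move=> s' s'0 ss' si'; rewrite -{1 2}c1.
    have -> : centred_pow (z i) 1 * value s * (centred_pow (z i) 1 * value s') =
        value ((i, 1%N) :: s ++ (i, 1%N) :: s').
      by rewrite big_cons big_cat big_cons/= !mulrA.
    apply: value_free => //; rewrite [sorted _ _]/= cat_path/=.
    have /= -> := neq_head 1 ss si; have /= -> := neq_head 1 ss' si'.
    (* The last factor of [s] has an index other than [i], so the two alternating halves can be
       joined. *)
    rewrite andbT/=; have /allP/(_ (last (i, 1%N) s)) := si.
    by case: (s) s0 => //= p t _; apply; exact: mem_last.
Qed.

Variable m : nat -> C.
Hypothesis z_moment : forall i e, tau (z i ^+ e) = m e.

(** The reduction of [free_value] with a count: moving a letter creates at most three products, with
    coefficients bounded by [1], [K] and [K], hence a factor [1 + K *+ 2] per letter. *)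
Lemma free_word_bound N : exists K, forall u : seq I, size u = N ->
  `|tau (word z u)| <= K.
Proof.
pose K := 1 + \sum_(e < N.+1) `|m e|.
have K1 : 1 <= K by rewrite lerDl sumr_ge0.
have mK e : (e <= N)%N -> `|m e| <= K.
  rewrite -ltnS => eN; rewrite /K (bigD1 (Ordinal eN))//= addrCA lerDl.
  by rewrite addr_ge0// sumr_ge0.
have K0 : 0 <= K by apply: le_trans K1; exact: ler01.
(* The condition on exponents keeps them at most [N] throughout the reduction, so that [K] bounds
   all the moments that appear. *)
suff H (u : seq I) s : sorted neqfst s -> all (fun p => p.2 + size u <= N)%N s ->
    (size u <= N)%N -> `|tau (word z u * value s)| <= (1 + K *+ 2) ^+ size u.
  exists ((1 + K *+ 2) ^+ N) => u uN; have := H u [::] isT isT; rewrite big_nil mulr1 uN.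
  exact.
elim/last_ind: u s => [|u i IH] s ss sN uN.
  rewrite /word big_nil mul1r expr0; have [->|s0] := eqVneq s [::].
    by rewrite big_nil tau1 normr1.
  by rewrite value_free// normr0.
rewrite size_rcons in sN uN *; rewrite /word big_rcons/= -mulrA -/(word z u).
have sN' : all (fun p : I * nat => p.2 + size u <= N)%N s.
  by apply: sub_all sN => p; rewrite addnS; exact: ltnW.
have [[e [s' sE]]|hs] : (exists e s', s = (i, e) :: s') \/ sorted neqfst ((i, 1%N) :: s).
- case: s ss {sN sN'} => [|[j e] s'] ss; first by right.
  by have [->|ij] := eqVneq i j; [left; exists e, s'|right; rewrite /= ij].
- rewrite sE in ss sN sN' *; have sN1 : all (fun p : I * nat => p.2 + size u <= N)%N s'.
    by case/andP: sN'.
  have ss' := path_sorted ss.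
  have eN : (e + size u < N)%N by case/andP: sN; rewrite addnS.
  have iN n : (n <= e.+1)%N -> all (fun p : I * nat => p.2 + size u <= N)%N ((i, n) :: s').
    by move=> ne; rewrite /= sN1 andbT (leq_trans _ eN)// -addSn leq_add2r.
  have -> : z i * value ((i, e) :: s') = value ((i, e.+1) :: s') +
      m e.+1 *: value s' - m e *: value ((i, 1%N) :: s').
    rewrite !big_cons/= (centred_pow1 (z_centred i)) mulrA mul_centred_pow !z_moment.
    by rewrite mulrBl mulrDl -!scalerAl mul1r.
  rewrite mulrBr mulrDr -!scalerAr raddfB/= tauD !tauZ.
  apply: (le_trans (ler_normB _ _)); rewrite exprS mulrDl mul1r mulrnAl mulr2n addrA.
  apply: lerD; [apply: (le_trans (ler_normD _ _)); apply: lerD|].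
  + by apply: IH => //; [case: (s') ss|exact: iN|exact: ltnW].
  + rewrite normrM ler_pM// ?mK ?IH//; last exact: ltnW.
    by rewrite (leq_trans _ eN)// ltnS leq_addr.
  + rewrite normrM ler_pM// ?mK ?IH//; [|by case: (s') ss|exact: iN|exact: ltnW].
    by rewrite (leq_trans _ (ltnW eN))// leq_addr.
- have -> : z i * value s = value ((i, 1%N) :: s).
    by rewrite big_cons /= (centred_pow1 (z_centred i)).
  apply: (@le_trans _ _ ((1 + K *+ 2) ^+ size u)).
    by apply: IH => //=; [rewrite sN' add1n uN|exact: ltnW].
  by rewrite ler_weXn2l// lerDl mulrn_wge0.
Qed.

End Freeness.

(** * Free and tensor-product sums *)

Section WordLemmas.
Variables (C : numClosedFieldType) (A : ncProbSpaceType C) (T : eqType).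

Lemma word_rcons (z : T -> A) u t : word z (rcons u t) = word z u * z t.
Proof. by rewrite /word big_rcons. Qed.

Lemma word_nil (z : T -> A) : word z [::] = 1.
Proof. by rewrite /word big_nil. Qed.

Lemma word_cons (z : T -> A) u t : word z (t :: u) = z t * word z u.
Proof. by rewrite /word big_cons. Qed.

Lemma monomial_cons (c : T -> nat -> A) t w j k :
  monomial c (t :: w) (j :: k) = c t j * monomial c w k.
Proof. by rewrite /monomial /= big_cons. Qed.

End WordLemmas.

Section FreeCLT.
Variables (C : numClosedFieldType) (A : ncProbSpaceType C) (b : nat -> A).
Hypothesis b_singleton : forall u i, count_mem i u = 1%N -> tau (word b u) = 0.
Hypothesis b_pair : forall (u v : seq nat) i, i \notin u -> i \notin v ->
  tau (b i * word b u * (b i * word b v)) = tau (word b u) * tau (word b v).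
Variable bd : nat -> C.
Hypothesis b_bound : forall u, `|tau (word b u)| <= bd (size u).

Lemma free_clt (w : seq unit) : exists2 K : C, 0 <= K & forall n, (0 < n)%N ->
  `|tau (word (clt_sum (fun=> b) n) (tt :: w)) -
    split_sum tt (fun=> 1) (fun u => tau (word (clt_sum (fun=> b) n) u)) w| <= K / sqrtC n%:R.
Proof.
have mE w' k : size k = size w' -> monomial (fun=> b) w' k = word b k.
  elim: w' k => [|t w' IH] [|j k] //= => [_|[/IH h]].
    by rewrite /monomial /word !big_nil.
  by rewrite monomial_cons word_cons h.
apply: (@clt_schwinger_dyson _ _ _ _ _ _ (fun w => bd (size w)))
  => [w' k sk|w' k j sk|w' k p sk pw].
- by rewrite mE// -sk; exact: b_bound.
- by rewrite mE//; exact: b_singleton.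
- have pk : (p < size k)%N by rewrite sk.
  move=> h1 h2; rewrite mul1r !mE/= ?sk ?size_take ?size_drop ?sk//.
  rewrite -(b_pair h1 h2) -mulrA -[b _ * word b (drop _ _)]word_cons -drop_nth//.
  by rewrite -word_cat cat_take_drop word_cons.
Qed.

Variables (alpha beta : C).

(* [true] stands for the letter with the classical-convolution limit, [false]
   for the letter with the semicircular limit. *)
Definition tensor_letter (t : bool) (j : nat) : (A ⊗ A)%type :=
  if t then alpha *: (b j ⊗ 1 + 1 ⊗ b j) else beta *: (b j ⊗ b j).

Local Notation mono := (monomial tensor_letter).
Local Notation "u ⊛ v" := (word b u ⊗ word b v : (A ⊗ A)%type) (at level 40).

(** Traces of monomials are computed by absorbing the letters one by one into an accumulator
    [u ⊛ u']: a letter [true] goes to either leg, a letter [false] to both. *)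
Let mulL u u' j x : (u ⊛ u') * (tensor_letter true j * x) =
  alpha *: ((rcons u j ⊛ u') * x) + alpha *: ((u ⊛ rcons u' j) * x).
Proof.
rewrite /tensor_letter mulrA -scalerAr mulrDr !tens_mulE !mulr1 -!word_rcons.
by rewrite -scalerAl mulrDl scalerDr.
Qed.

Let mulB u u' j x : (u ⊛ u') * (tensor_letter false j * x) =
  beta *: ((rcons u j ⊛ rcons u' j) * x).
Proof.
by rewrite /tensor_letter mulrA -scalerAr !tens_mulE -!word_rcons -scalerAl.
Qed.

Let tensor_bound w p p' : exists K, forall k u u', size k = size w ->
  size u = p -> size u' = p' -> `|tau ((u ⊛ u') * mono w k)| <= K.
Proof.
elim: w p p' => [|t w IH] p p'.
  exists (bd p * bd p') => -[] // u u' _ <- <-.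
  by rewrite /monomial big_nil mulr1 tauE normrM ler_pM.
case: t.
  have [K1 h1] := IH p.+1 p'; have [K2 h2] := IH p p'.+1.
  exists (`|alpha| * K1 + `|alpha| * K2) => -[|j k] // u u' [sk] su su'.
  rewrite monomial_cons mulL tauD !tauZ (le_trans (ler_normD _ _))//.
  by rewrite !normrM lerD// ler_wpM2l// ?h1 ?h2// size_rcons ?su ?su'.
have [K h] := IH p.+1 p'.+1.
exists (`|beta| * K) => -[|j k] // u u' [sk] su su'.
by rewrite monomial_cons mulB tauZ normrM ler_wpM2l// h// size_rcons ?su ?su'.
Qed.

(** The disjunction is an invariant of the absorption: once the only letter of index [j] is
    absorbed, some leg holds [j] exactly once and no later letter has that index, so the trace of
    that leg is [0]. *)
Let tensor_singleton w k u u' j : size k = size w ->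
  [|| [&& count_mem j k == 1%N, count_mem j u == 0%N & count_mem j u' == 0%N],
      (count_mem j k == 0%N) && (count_mem j u == 1%N) |
      (count_mem j k == 0%N) && (count_mem j u' == 1%N)] ->
  tau ((u ⊛ u') * mono w k) = 0.
Proof.
elim: w k u u' => [|t w IH] [|i k] u u' //=.
  rewrite /monomial big_nil mulr1 tauE => _.
  by case/orP => /eqP h; rewrite (b_singleton h) ?mul0r ?mulr0.
case=> sk; rewrite monomial_cons => h.
by case: t; rewrite ?mulL ?mulB ?tauD !tauZ !IH ?mulr0 ?addr0//;
  move: h; rewrite -!cats1 !count_cat/=; case: (i == j);
  case: (count_mem j k) => [|[|?]]; case: (count_mem j u) => [|[|?]];
  case: (count_mem j u') => [|[|?]]; rewrite ?addn0 ?addn1.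
Qed.
(** Later letters only lengthen [v] and [v']; when none is left, [b_pair] factorises each leg. *)
Let tensor_pair_tail w k u u' v v' j : size k = size w ->
  j \notin u -> j \notin u' -> j \notin v -> j \notin v' -> j \notin k ->
  tau (((j :: u ++ j :: v) ⊛ (j :: u' ++ j :: v')) * mono w k) =
  tau (u ⊛ u') * tau ((v ⊛ v') * mono w k).
Proof.
elim: w k v v' => [|t w IH] [|i k] v v' //=.
  move=> _ ju ju' jv jv' _; rewrite /monomial big_nil !mulr1 !tauE.
  have E x y : word b (j :: x ++ j :: y) = b j * word b x * (b j * word b y).
    by rewrite word_cons word_cat word_cons !mulrA.
  by rewrite !E !b_pair//; ring.
case=> sk ju ju' jv jv'; rewrite inE negb_or => /andP[ji jk].
have rE x y : rcons (j :: x ++ j :: y) i = j :: x ++ j :: rcons y i.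
  by rewrite /= rcons_cat.
by rewrite monomial_cons; case: t; rewrite ?mulL ?mulB ?tauD !tauZ ?rE !IH//;
  rewrite ?mem_rcons ?inE ?negb_or ?ji//; ring.
Qed.

(** The letters before position [p] lengthen [u] and [u']. At [p], a letter [true] repeats the
    leading index in one leg only and leaves it single in the other, so the trace vanishes; a letter
    [false] repeats it in both, and [tensor_pair_tail] applies. *)
Let tensor_pair w k u u' p : size k = size w -> (p < size w)%N ->
  nth 0%N k p \notin u -> nth 0%N k p \notin u' ->
  nth 0%N k p \notin take p k -> nth 0%N k p \notin drop p.+1 k ->
  tau (((nth 0%N k p :: u) ⊛ (nth 0%N k p :: u')) * mono w k) =
  (if nth false w p then 0 else beta) *
    (tau ((u ⊛ u') * mono (take p w) (take p k)) * tau (mono (drop p.+1 w) (drop p.+1 k))).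
Proof.
elim: w k u u' p => [|t w IH] [|i k] u u' [|p] //= [sk].
  move=> _ iu iu' _; rewrite !drop0 => ik; rewrite monomial_cons.
  have i0 x : i \notin x -> count_mem i x = 0%N by move=> ix; apply/count_memPn.
  case: t.
    rewrite mul0r mulL tauD !tauZ !(@tensor_singleton _ _ _ _ i) ?mulr0 ?addr0//.
    - by rewrite -cats1 count_cat/= !eqxx !i0.
    - by rewrite -cats1 count_cat/= !eqxx !i0.
  rewrite mulB tauZ -!cats1 !cat_cons (@tensor_pair_tail _ _ _ _ [::] [::])//.
  by rewrite word_nil /monomial big_nil mulr1 mul1r.
rewrite ltnS => pw ju ju'; rewrite inE negb_or => /andP[ji jt] jd.
by rewrite !monomial_cons; case: t; rewrite !(mulL, mulB) !rcons_cons !(tauD, tauZ) !IH//;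
  rewrite ?mem_rcons ?inE ?negb_or ?ji//; case: ifP => _; ring.
Qed.

Lemma tensor_clt (w : seq bool) : exists2 K : C, 0 <= K & forall n, (0 < n)%N ->
  `|tau (word (clt_sum tensor_letter n) (false :: w)) -
    split_sum false (fun t => if t then 0 else beta ^+ 2)
      (fun u => tau (word (clt_sum tensor_letter n) u)) w| <= K / sqrtC n%:R.
Proof.
have E x : (([::] : seq nat) ⊛ [::]) * x = x by rewrite word_nil mul1r.
have [bd' bdP] := choice (fun w => tensor_bound w 0 0).
apply: (@clt_schwinger_dyson _ _ _ _ _ _ bd') => [w' k sk|w' k j sk cj|w' k p sk pw h1 h2].
- by rewrite -[monomial _ _ _]E; exact: bdP.
- by rewrite -[monomial _ _ _]E (@tensor_singleton _ _ _ _ j)// cj.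
(* The leading letter supplies the second factor [beta] of the covariance. *)
- rewrite monomial_cons -[_ * _]E mulB tauZ tensor_pair// E.
  by case: nth; ring.
Qed.

End FreeCLT.

(** * Moments of the semicircle law and of convolutions *)

Section SemicircleMoments.
Variable R : realType.
Local Notation leb := (@lebesgue_measure R).
Local Notation sc := (semicircle_prob R).
Local Notation M := (moment sc).

Lemma semicircle_support : [set x : R | `|x| <= 2] = `[-2, 2]%classic.
Proof. by apply/seteqP; split => x /=; rewrite in_itv/= ler_norml. Qed.

Lemma semicircle_prob_dom : sc `<< leb.
Proof.
apply/null_content_dominatesP => A mA A0; rewrite /= /semicircle_prob.
apply: null_set_integral => //; apply/measurable_EFinP/measurable_funTS.
exact: measurable_semicircle_pdf.
Qed.

Lemma semicircle_prob_setC : sc (~` `[-2, 2]%classic) = 0%E.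
Proof.
rewrite /= /semicircle_prob; apply: integral0_eq => x /= xC.
rewrite /semicircle_pdf semicircle_support indicE memNset//.
by rewrite mulr0.
Qed.

Lemma integrable_semicircleX m :
  (sc : {measure set _ -> \bar R}).-integrable setT (EFin \o (fun x : R => x ^+ m)).
Proof.
have mX : measurable_fun [set: R] (fun x : R => x ^+ m) by exact: measurable_funX.
have mC : measurable (~` `[-2, 2]%classic : set (measurableTypeR R)).
  by apply: measurableC; exact: measurable_itv.
apply: (negligible_integrable mC _ _ semicircle_prob_setC).2 => //.
  by apply/measurable_EFinP.
rewrite setTD setCK; apply: measurable_bounded_integrable.
- exact: measurable_itv.
- apply: le_lt_trans (ltry 1); rewrite -(@probability_setT _ _ _ sc).
  by apply: le_measure => //; rewrite inE; [exact: measurable_itv|exact: measurableT].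
- exact: measurable_funTS.
- exists (2 ^+ m); split; first exact: num_real.
  move=> r rm x /=; rewrite in_itv/= -ler_norml => x2.
  by rewrite normrX (le_trans _ (ltW rm))// lerXn2r// nnegrE.
Qed.

Let g (x : R) : R := (2 * pi)^-1 * Num.sqrt (4 - x ^+ 2).

(** The Radon-Nikodym change of variables applies, and the derivative is almost everywhere the
    density because both have the same integral over every measurable set. *)
Lemma moment_semicircleE m :
  (M m)%:E = (\int[leb]_(x in `[(-2)%R, 2%R]) (x ^+ m * g x)%:E)%E.
Proof.
have iX := integrable_semicircleX m.
have mX : measurable_fun [set: R] (fun x : R => x ^+ m) by exact: measurable_funX.
have mg := @measurable_semicircle_pdf R.
rewrite /moment /Rintegral fineK; last by apply: integrable_fin_num.
rewrite -(Radon_Nikodym_change_of_variables semicircle_prob_dom)//=.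
transitivity (\int[leb]_x (x ^+ m * semicircle_pdf x)%:E)%E.
  under [RHS]eq_integral do rewrite EFinM.
  apply: ae_eq_integral => //.
  - apply: emeasurable_funM; first exact/measurable_EFinP.
    apply: (measurable_int leb); apply: Radon_Nikodym_integrable.
    exact: semicircle_prob_dom.
  - by apply: emeasurable_funM; exact/measurable_EFinP.
  - apply: ae_eqe_mul2l; rewrite Radon_NikodymE//=; first exact: semicircle_prob_dom.
    move=> dom; case: cid => /= h [h1 h2 h3].
    apply: integral_ae_eq => //=; first exact/measurable_EFinP.
    by move=> E _ mE; rewrite -h3.
rewrite [RHS]integral_mkcond; apply: eq_integral => x _.
rewrite patchE /semicircle_pdf semicircle_support indicE.
by case: ifPn => _; rewrite ?mulr1 ?mulr0.
Qed.

Lemma moment_semicircle0 : M 0 = 1.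
Proof.
rewrite /moment; under eq_Rintegral do rewrite expr0.
rewrite Rintegral_cst//. by rewrite mul1r [X in fine X]semicircle_setT.
Qed.

(** This is [(4 - x^2)^(3/2) x^m], which vanishes at [-2] and [2]; integrating its derivative yields
    the moment recursion. *)
Let F m (x : R) : R := ((4 - x ^+ 2) * Num.sqrt (4 - x ^+ 2)) * x ^+ m.

Let dF m (x : R) : -2 < x < 2 -> is_derive x (1 : R) (F m)
  ((4 * m%:R * x ^+ m.-1 - m.+3%:R * x ^+ m.+1) * Num.sqrt (4 - x ^+ 2)).
Proof.
move=> x2; have x4 : 0 < 4 - x ^+ 2 by nra.
have s0 : Num.sqrt (4 - x ^+ 2) != 0 by rewrite gt_eqF// sqrtr_gt0.
have ss : Num.sqrt (4 - x ^+ 2) ^+ 2 = 4 - x ^+ 2 by rewrite sqr_sqrtr// ltW.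
have d1 : is_derive x (1 : R) (fun x : R => 4 - x ^+ 2) (- 2 * x).
  by apply: is_derive_eq; rewrite /GRing.scale/=; ring.
have d2 : is_derive x (1 : R) (fun x : R => Num.sqrt (4 - x ^+ 2))
    (- x / Num.sqrt (4 - x ^+ 2)).
  have d3 := is_derive1_sqrt x4.
  apply: (is_derive_eq (@is_derive1_comp _ Num.sqrt (fun x : R => 4 - x ^+ 2) x _ _ d3 d1)).
  by move: s0; set s := Num.sqrt _ => s0; field.
have dX : is_derive x (1 : R) (fun x : R => x ^+ m) (m%:R * x ^+ m.-1).
  have := is_deriveX m (is_derive_id x (1 : R)); rewrite exprfctE => h.
  by apply: (is_derive_eq h); rewrite /GRing.scale/= mulr1.
refine (is_derive_eq (is_deriveM (is_deriveM d1 d2) dX) _).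
change ((4 - x ^+ 2) * Num.sqrt (4 - x ^+ 2) * (m%:R * x ^+ m.-1) +
  x ^+ m * ((4 - x ^+ 2) * (- x / Num.sqrt (4 - x ^+ 2)) +
   Num.sqrt (4 - x ^+ 2) * (-2 * x)) =
  (4 * m%:R * x ^+ m.-1 - m.+3%:R * x ^+ m.+1) * Num.sqrt (4 - x ^+ 2)).
move: ss s0; set s := Num.sqrt _ => ss s0.
have -> : (4 - x ^+ 2) * (- x / s) = - x * s by rewrite -ss; field.
clear dX; case: m => [|m] /=; first by rewrite expr0 expr1; ring.
by rewrite !exprS -(natr1 m.+3) -(natr1 m.+2) -(natr1 m.+1); ring.
Qed.

(** For [m = 0] the factor [m%:R] makes the truncated [m.-1] harmless, and the mean comes out as
    [0]. *)
Lemma moment_semicircle_rec m : m.+3%:R * M m.+1 = 4 * m%:R * M m.-1.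
Proof.
have cg (f : R -> R) : continuous f -> {within `[-2, 2], continuous (fun x => f x * g x)}.
  move=> cf; apply: continuous_subspaceT => x.
  apply: cvgM; [exact: cf|apply: cvgM; first exact: cvg_cst].
  apply: (@continuous_comp _ _ _ (fun x : R => 4 - x ^+ 2)); last exact: sqrt_continuous.
  by apply: cvgB; [exact: cvg_cst|exact: exprn_continuous].
have ME k : M k = \int[leb]_(x in `[(-2)%R, 2%R]) (x ^+ k * g x).
  by rewrite /Rintegral -moment_semicircleE.
have iX k : leb.-integrable `[(-2)%R, 2%R] (EFin \o (fun x => x ^+ k * g x)).
  apply: continuous_compact_integrable; first exact: segment_compact.
  by apply: cg; exact: exprn_continuous.
apply/esym/eqP; rewrite -subr_eq0 !ME -!RintegralZl// -RintegralB//; first last.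
- have h := integrableZl _ m.+3%:R (iX m.+1); apply: h; exact: measurable_itv.
- have h := integrableZl _ (4 * m%:R) (iX m.-1); apply: h; exact: measurable_itv.
pose f x : R := (4 * m%:R * x ^+ m.-1 - m.+3%:R * x ^+ m.+1) * g x.
rewrite (_ : (fun x => _) = f); last by apply/funext => x; rewrite /f; ring.
rewrite /Rintegral (@continuous_FTC2 _ f (fun x => (2 * pi)^-1 * F m x))//.
- have F2 : F m 2 = 0 by rewrite /F (_ : 4 - 2 ^+ 2 = 0) ?mul0r//; ring.
  have F2' : F m (-2) = 0 by rewrite /F (_ : 4 - (-2) ^+ 2 = 0) ?mul0r//; ring.
  by rewrite F2 F2' !mulr0 subee.
- by lra.
- apply: cg => x; apply: cvgB; apply: cvgM; try exact: cvg_cst; exact: exprn_continuous.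
- have cF : continuous (fun x => (2 * pi)^-1 * F m x).
    move=> x; apply: cvgM; first exact: cvg_cst.
    apply: cvgM; last exact: exprn_continuous.
    have c4 : continuous (fun x : R => 4 - x ^+ 2).
      by move=> y; apply: cvgB; [exact: cvg_cst|exact: exprn_continuous].
    apply: cvgM; first exact: c4.
    apply: (@continuous_comp _ _ _ (fun x : R => 4 - x ^+ 2)); first exact: c4.
    exact: sqrt_continuous.
  split.
  + move=> x; rewrite in_itv/= => /dF h.
    by apply: derivableM => //; case: (h m).
  + exact/cvg_at_right_filter/cF.
  + exact/cvg_at_left_filter/cF.
- move=> x; rewrite in_itv/= => /dF h; rewrite derive1E.
  have hm := h m; rewrite deriveM//.
  rewrite derive_cst (@derive_val _ _ _ _ _ _ _ hm) /f /g /GRing.scale/= mulr0 addr0; ring.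
Qed.

End SemicircleMoments.

(** * Moments of dilations and classical convolutions *)

Section MomentCalculus.
Variable R : realType.
Local Notation law := (probability (measurableTypeR R) R).

(** [moment] is a real number extracted from an extended one, so integrability has to accompany the
    computations. *)
Definition has_moments (mu : law) : Prop :=
  forall m, mu.-integrable setT (EFin \o (fun x : R => x ^+ m)).

Lemma EFin_moment (mu : law) m : has_moments mu ->
  (\int[mu]_x (x ^+ m)%:E = (moment mu m)%:E)%E.
Proof. by move=> /(_ m) h; rewrite /moment /Rintegral fineK//; exact: integrable_fin_num h. Qed.

Let mX m : measurable_fun [set: measurableTypeR R]
  (EFin \o (fun x : measurableTypeR R => x ^+ m)).
Proof. by apply/measurable_EFinP; exact: measurable_funX. Qed.

Let integrable_dilationX t (mu : law) m : has_moments mu ->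
  mu.-integrable (scale_fun t @^-1` setT)
    ((EFin \o (fun x : R => x ^+ m)) \o scale_fun t).
Proof.
move=> /(_ m) h; rewrite preimage_setT.
have := integrableZl measurableT (t ^+ m) h.
by apply: eq_integrable => // x _; rewrite /= /scale_fun exprMn EFinM.
Qed.

Lemma has_moments_dilation t (mu : law) : has_moments mu ->
  has_moments (dilation t mu).
Proof.
move=> h m; apply: integrable_pushforward => //.
exact: integrable_dilationX.
Qed.

Lemma moment_dilation t (mu : law) m : has_moments mu ->
  moment (dilation t mu) m = t ^+ m * moment mu m.
Proof.
move=> h; apply: EFin_inj; rewrite -EFin_moment; last exact: has_moments_dilation.
rewrite (integral_pushforward _ _ (integrable_dilationX t m h))//=.
rewrite preimage_setT EFinM -EFin_moment// -integralZl//; last exact: h.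
by apply: eq_integral => x _; rewrite /= /scale_fun exprMn EFinM.
Qed.

Let integrable_prodX (mu nu : law) i j : has_moments mu -> has_moments nu ->
  (mu \x nu)%E.-integrable setT (fun z : measurableTypeR R * measurableTypeR R =>
    (z.1 ^+ i * z.2 ^+ j)%:E).
Proof.
move=> hmu hnu.
have mf : measurable_fun [set: measurableTypeR R * measurableTypeR R]
    (fun z => (z.1 ^+ i * z.2 ^+ j)%:E : \bar R).
  apply/measurable_EFinP; apply: measurable_funM;
    apply: measurable_funX; [exact: measurable_fst|exact: measurable_snd].
apply/(integrable12ltyP _ _ mf).
have /integrableP[_ fi] := hmu i; have /integrableP[_ fj] := hnu j.
under eq_integral => x _.
  under eq_integral => y _ do rewrite /= normrM EFinM.
  rewrite ge0_integralZl//; last first.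
    by apply/measurable_EFinP; apply: measurableT_comp => //; exact: measurable_funX.
  over.
move: fi fj => /=; set J := (\int[nu]_x _)%E => fi fj.
have J0 : (0 <= J)%E by apply: integral_ge0 => x _; rewrite lee_fin.
have Jf : J \is a fin_num by rewrite ge0_fin_numE.
rewrite -(fineK Jf) ge0_integralZr ?lee_fin ?fine_ge0//; last first.
  by apply/measurable_EFinP; apply: measurableT_comp => //; exact: measurable_funX.
rewrite muleC lte_mul_pinfty ?lee_fin ?fine_ge0//.
Qed.

Let integral_prodX (mu nu : law) i j : has_moments mu -> has_moments nu ->
  (\int[mu \x nu]_z (z.1 ^+ i * z.2 ^+ j)%:E = (moment mu i * moment nu j)%:E)%E.
Proof.
move=> hmu hnu.
rewrite -(integral12_prod_meas1 (integrable_prodX i j hmu hnu))/=.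
under eq_integral => x _.
  rewrite /fubini_F.
  under eq_integral => y _ do rewrite /= EFinM.
  rewrite integralZl//; last exact: hnu.
  rewrite EFin_moment//; over.
rewrite /= integralZr//; last exact: hmu.
by rewrite EFin_moment// EFinM.
Qed.

Let add_expn m (z : measurableTypeR R * measurableTypeR R) :
  (EFin \o (fun x : R => x ^+ m)) (add_fun2 z) =
  (\sum_(i <- index_enum 'I_m.+1)
    ('C(m, i)%:R)%:E * (z.1 ^+ (m - i) * z.2 ^+ i)%:E)%E.
Proof.
rewrite /= /add_fun2 exprDn -sumEFin; apply: eq_bigr => i _.
by rewrite -mulr_natl EFinM.
Qed.

Let integrable_convX (mu nu : law) m : has_moments mu -> has_moments nu ->
  (mu \x nu)%E.-integrable (@add_fun2 R @^-1` setT)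
    ((EFin \o (fun x : R => x ^+ m)) \o @add_fun2 R).
Proof.
move=> hmu hnu; rewrite preimage_setT.
rewrite (_ : _ \o _ = (fun z => \sum_(i <- index_enum 'I_m.+1)
    ('C(m, i)%:R)%:E * (z.1 ^+ (m - i) * z.2 ^+ i)%:E)%E); last first.
  by apply/funext => z; exact: add_expn.
apply: integrable_sum => // i _; apply: integrableZl => //.
exact: integrable_prodX.
Qed.

Lemma has_moments_conv (mu nu : law) : has_moments mu -> has_moments nu ->
  has_moments (classical_conv mu nu).
Proof.
move=> hmu hnu m; apply: integrable_pushforward => //.
exact: integrable_convX.
Qed.

Lemma moment_conv (mu nu : law) m : has_moments mu -> has_moments nu ->
  moment (classical_conv mu nu) m =
  \sum_(i < m.+1) 'C(m, i)%:R * (moment mu (m - i) * moment nu i).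
Proof.
move=> hmu hnu; apply: EFin_inj; rewrite -EFin_moment; last exact: has_moments_conv.
rewrite (integral_pushforward _ _ (integrable_convX m hmu hnu))//.
rewrite preimage_setT.
rewrite (_ : _ \o _ = (fun z => \sum_(i <- index_enum 'I_m.+1)
    ('C(m, i)%:R)%:E * (z.1 ^+ (m - i) * z.2 ^+ i)%:E)%E); last first.
  by apply/funext => z; exact: add_expn.
rewrite integral_sum//; last first.
  by move=> i; apply: integrableZl => //; exact: integrable_prodX.
rewrite -sumEFin; apply: eq_bigr => i _.
by rewrite integralZl//; [rewrite integral_prodX|exact: integrable_prodX].
Qed.

End MomentCalculus.

(** * Chebyshev polynomials *)

Section Chebyshev.
Variables (K : comNzRingType) (A : algType K) (v : K) (y : A).

(* For [v = 1] these are the Chebyshev polynomials of the second kind in y/2. *)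
Fixpoint cheb (k : nat) : A :=
  match k with
  | 0 => 1
  | (k1.+1 as k2) => match k1 with 0 => y | k0.+1 => y * cheb k1 - v *: cheb k0 end
  end.

Lemma cheb0 : cheb 0 = 1. Proof. by []. Qed.
Lemma cheb1 : cheb 1 = y. Proof. by []. Qed.
Lemma chebSS k : cheb k.+2 = y * cheb k.+1 - v *: cheb k. Proof. by []. Qed.

End Chebyshev.
Arguments cheb : simpl never.

(** * Orthogonality of the Chebyshev polynomials and the Catalan recursion *)

Section MomentFunctional.
Variables (R : realFieldType) (M : nat -> R).
Hypothesis M0 : M 0 = 1.
Hypothesis M_rec : forall m, m.+3%:R * M m.+1 = 4 * m%:R * M m.-1.

Definition poly_moment (p : {poly R}) : R := \sum_(i < size p) p`_i * M i.
Local Notation E := poly_moment.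

Lemma poly_momentE n (p : {poly R}) : (size p <= n)%N ->
  E p = \sum_(i < n) p`_i * M i.
Proof.
move=> pn; rewrite /E -(big_mkord predT (fun i => p`_i * M i)).
rewrite -(big_mkord predT (fun i => p`_i * M i)) [RHS](big_cat_nat _ (n := size p))//=.
rewrite [X in _ = _ + X]big_nat [X in _ = _ + X]big1 ?addr0// => i /andP[pi _].
by rewrite nth_default ?mul0r.
Qed.

Fact poly_moment_linear : linear_for *%R E.
Proof.
move=> c p q; pose n := maxn (size (c *: p + q)) (maxn (size p) (size q)).
rewrite !(@poly_momentE n) ?leq_max ?leqnn ?orbT//.
rewrite mulr_sumr -big_split; apply: eq_bigr => i _ /=.
by rewrite coefD coefZ mulrDl mulrA.
Qed.

HB.instance Definition _ :=
  GRing.isLinear.Build R {poly R} R *%R poly_moment poly_moment_linear.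

Lemma poly_momentXn m : E 'X^m = M m.
Proof.
rewrite /E size_polyXn big_ord_recr/= coefXn eqxx mul1r big1 ?add0r// => i _.
by rewrite coefXn ltn_eqF ?mul0r.
Qed.

(* The integrand is the derivative of [(4 - x^2)^(3/2) p(x)] divided by
   [sqrt (4 - x^2)]. *)
Lemma poly_moment_ibp p : E ((4%:P - 'X^2) * p^`() - 3 *: ('X * p)) = 0.
Proof.
have X m : E ((4%:P - 'X^2) * ('X^m)^`() - 3 *: ('X * 'X^m)) = 0.
  have -> : (4%:P - 'X^2) * ('X^m)^`() - 3 *: ('X * 'X^m) =
      (4 * m%:R) *: 'X^(m.-1) - m.+3%:R *: 'X^(m.+1) :> {poly R}.
    case: m => [|m]; rewrite derivXn/=.
      by rewrite -!mul_polyC !polyC_natr; ring.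
    rewrite -!mul_polyC polyCM !polyC_natr -['X^m *+ _]mulr_natl !exprS.
    by rewrite -(natr1 m.+3) -(natr1 m.+2) -(natr1 m.+1); ring.
  rewrite raddfB/= !linearZ/= !poly_momentXn.
  by rewrite /GRing.scale/= mulrN M_rec subrr.
rewrite -[p]coefK poly_def; elim/big_rec: _ => [|i q _ IH].
  by rewrite deriv0 !mulr0 scaler0 subrr raddf0.
have -> : (4%:P - 'X^2) * (p`_i *: 'X^i + q)^`() - 3 *: ('X * (p`_i *: 'X^i + q)) =
    p`_i *: ((4%:P - 'X^2) * ('X^i)^`() - 3 *: ('X * 'X^i)) +
    ((4%:P - 'X^2) * q^`() - 3 *: ('X * q)).
  by rewrite derivD derivZ -!mul_polyC; ring.
by rewrite linearP/= X IH mulr0 addr0.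
Qed.

Local Notation V := (cheb 1 ('X : {poly R})).

(** Two consecutive indices go through the induction together, the next case following by
    differentiating the three-term recurrence. *)
Lemma deriv_cheb k : (4%:P - 'X^2) * (V k.+1)^`() =
  k.+3%:R *: V k - k.+1%:R *: V k.+2.
Proof.
suff : (4%:P - 'X^2) * (V k.+1)^`() = k.+3%:R *: V k - k.+1%:R *: V k.+2 /\
  (4%:P - 'X^2) * (V k.+2)^`() = k.+4%:R *: V k.+1 - k.+2%:R *: V k.+3 by case.
elim: k => [|k [IH1 IH2]].
  rewrite !chebSS cheb1 cheb0 !scale1r derivB derivM derivX derivC.
  rewrite -!mul_polyC !polyC_natr. split; ring.
have SS n : V n.+2 = 'X * V n.+1 - V n by rewrite chebSS scale1r.
split=> //; have -> : (4%:P - 'X^2) * (V k.+3)^`() = (4%:P - 'X^2) * V k.+2 +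
    'X * ((4%:P - 'X^2) * (V k.+2)^`()) - (4%:P - 'X^2) * (V k.+1)^`().
  by rewrite (SS k.+1) derivB derivM derivX; ring.
rewrite IH1 IH2 (SS k.+2) (SS k.+1) (SS k) -!mul_polyC !polyC_natr.
rewrite -(natr1 k.+4) -(natr1 k.+3) -(natr1 k.+2) -(natr1 k.+1); ring.
Qed.

Lemma poly_moment_cheb k : E (V k.+1) = 0.
Proof.
(* Integration by parts with [p := V n.+1]. The case [n = 0] starts the even indices, and [M 1 = 0]
   the odd ones. *)
have step n : n.+4%:R * E (V n.+2) = n%:R * E (V n).
  have := poly_moment_ibp (V n.+1); rewrite deriv_cheb.
  have -> : 'X * V n.+1 = V n.+2 + V n by rewrite chebSS scale1r subrK.
  rewrite scalerDr !raddfB/= !raddfD/= !linearZ/= => h.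
  apply/eqP; rewrite -subr_eq0 -oppr_eq0 -[X in _ == X]h; apply/eqP.
  rewrite -(natr1 n.+3) -(natr1 n.+2) -(natr1 n.+1) -(natr1 n) /GRing.scale/=; ring.
have pos n : n.+1%:R != 0 :> R by rewrite pnatr_eq0.
suff : E (V k.+1) = 0 /\ E (V k.+2) = 0 by case.
elim: k => [|k [IH1 IH2]].
  split; last first.
    by apply: (mulfI (pos 3)); rewrite step mul0r mulr0.
  apply: (mulfI (pos 2)); rewrite mulr0 cheb1 -['X]expr1 poly_momentXn M_rec.
  by rewrite mulr0 mul0r.
by split=> //; apply: (mulfI (pos k.+4)); rewrite step IH1 !mulr0.
Qed.

(** The case [k = 0] is the Catalan recursion; larger [k] enter because the induction on [n] uses
    ['X * V k.+1 = V k.+2 + V k]. *)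
Lemma poly_momentXncheb k n : E ('X^n * V k.+1) =
  \sum_(i < n) M i * E ('X^(n - i.+1) * V k).
Proof.
elim: n k => [|n IH] k; first by rewrite big_ord0 expr0 mul1r poly_moment_cheb.
rewrite exprSr -mulrA.
(* The summand [i = n] comes from the constant in ['X^2 = V 2 + 1] when [k = 0], and vanishes by
   [poly_moment_cheb] otherwise. *)
have [->|[l kl]] : k = 0 \/ exists l, k = l.+1 by case: k => [|l]; [left|right; exists l].
  rewrite cheb1 -expr2.
  have -> : 'X^2 = V 2 + 1 by rewrite chebSS scale1r cheb1 cheb0 subrK.
  rewrite mulrDr mulr1 raddfD/= IH big_ord_recr/= subnn poly_momentXn cheb0.
  rewrite expr0 mul1r -{2}(expr0 ('X : {poly R})) poly_momentXn M0 mulr1; congr (_ + _).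
  apply: eq_bigr => i _; rewrite cheb1 -exprSr subSS subnSK//.
  by rewrite mulr1.
have XV m : 'X * V m.+1 = V m.+2 + V m by rewrite chebSS scale1r subrK.
rewrite XV mulrDr raddfD/= IH kl IH -big_split/= big_ord_recr/= subnn expr0 mul1r.
rewrite poly_moment_cheb mulr0 addr0; apply: eq_bigr => i _.
by rewrite subSS -mulrDr -raddfD/= -mulrDr -XV mulrA -exprSr subnSK.
Qed.

Lemma moment_convolution n : M n.+1 = \sum_(i < n) M i * M (n - i.+1).
Proof.
rewrite -poly_momentXn exprSr -[X in _ * X](cheb1 1) poly_momentXncheb.
by apply: eq_bigr => i _; rewrite cheb0 mulr1 poly_momentXn.
Qed.
End MomentFunctional.

(** * The Schwinger-Dyson equation of a free semicircular element *)

Section FreeSemicircular.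
Variables (C : numClosedFieldType) (A : ncProbSpaceType C) (x y : A) (v : C).
Local Notation z := (fun t : bool => if t then x else y).
Hypothesis xy_free : free_family z.
Hypothesis y_cheb : forall k, tau (cheb v y k.+1) = 0.

(* Alternating products of centred powers of [x] (one [Some e] each) and
   Chebyshev polynomials of [y], where a run of [k] letters [None] encodes the
   [k]-th polynomial. *)
Fixpoint stack_value (s : seq (option nat)) : A :=
  match s with
  | [::] => 1
  | Some e :: s1 => centred_pow x e * stack_value s1
  | None :: s1 => y * stack_value s1 -
      match s1 with None :: s2 => v *: stack_value s2 | _ => 0 end
  end.

Arguments stack_value : simpl never.

Let stackS e s : stack_value (Some e :: s) = centred_pow x e * stack_value s.
Proof. by []. Qed.
Let stack1 : stack_value [:: None] = y.
Proof. by rewrite /stack_value mulr1 subr0. Qed.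
Let stackNS e s : stack_value (None :: Some e :: s) = y * stack_value (Some e :: s).
Proof. by rewrite {1}/stack_value subr0. Qed.
Let stackNN s : stack_value [:: None, None & s] = y * stack_value (None :: s) - v *: stack_value s.
Proof. by []. Qed.

Definition some_head (s : seq (option nat)) := if s is None :: _ then false else true.

Local Notation valid := (sorted (fun a b : option nat => ~~ (isSome a && isSome b))).
Local Notation neqfst := (fun p q : bool * A => p.1 != q.1).
Local Notation centred_in p := (gen_subalg [set z p.1] p.2 /\ tau p.2 = 0).

Lemma stack_value_run k s : some_head s ->
  stack_value (nseq k None ++ s) = cheb v y k * stack_value s.
Proof.
move=> hs; suff : stack_value (nseq k None ++ s) = cheb v y k * stack_value s /\
  stack_value (nseq k.+1 None ++ s) = cheb v y k.+1 * stack_value s by case.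
elim: k => [|k [IH1 IH2]].
  rewrite cheb0 cheb1 mul1r /=; split=> //.
  by case: s hs => [|[e|] s] //= _; rewrite ?stackNS// stack1 mulr1.
by split=> //; rewrite chebSS mulrBl -mulrA -IH2 -scalerAl -IH1.
Qed.

Lemma cheb_gen_subalg k : gen_subalg [set y] (cheb v y k).
Proof.
have gy : gen_subalg [set y] y by apply: gen_subalg_sub.
suff : gen_subalg [set y] (cheb v y k) /\ gen_subalg [set y] (cheb v y k.+1) by case.
elim: k => [|k [IH1 IH2]]; first by split; [exact: gen_subalg1|].
split=> //; rewrite chebSS addrC -scaleNr; apply: gen_subalgP => //.
exact: gen_subalgM.
Qed.

(** The leading run of [None] is kept apart because it may still be lengthened. The condition on [l]
    makes a nonempty rest start with a factor in [x], so that a Chebyshev factor may precede it. *)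
Let stack_alternating s : valid s -> exists k s0 (l : seq (bool * A)),
  [/\ s = nseq k None ++ s0, some_head s0,
      (if s0 is [::] then l == [::] else if l is p :: _ then p.1 else false),
      stack_value s0 = \prod_(p <- l) p.2 &
      sorted neqfst l /\ forall p, p \in l -> centred_in p].
Proof.
elim: s => [|[e|] s IH] sv.
- by exists 0%N, [::], [::]; split => //=; rewrite big_nil.
- have [k [s0 [l [sE s0h l0 s0v [ls lc]]]]] := IH (path_sorted sv).
  exists 0%N, (Some e :: s), ((true, centred_pow x e) ::
    (if k is 0 then [::] else [:: (false, cheb v y k)]) ++ l).
  have xc : centred_in (true, centred_pow x e).
    split; last exact: tau_centred_pow.
    rewrite /= /centred_pow -scaleNr addrC; apply: gen_subalgP; first exact: gen_subalg1.
    by apply: gen_subalgX; exact: gen_subalg_sub.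
  split => //.
  + rewrite stackS sE stack_value_run// s0v big_cons big_cat/=; congr (_ * (_ * _)).
    by case: (k) => [|k']; rewrite ?big_nil// big_seq1.
  + case: k sE => [|k] sE /=.
      case: s0 s0h l0 sE {s0v} => [_ /eqP -> _|[e'|] s0 // _ _ sE].
        by split=> // p; rewrite inE => /eqP ->.
      by move: sv; rewrite sE.
    split.
      by case: s0 l0 {sE s0h s0v} => [/eqP -> //|_ _]; case: (l) ls => //= p l' -> ->.
    move=> p; rewrite !inE => /or3P[/eqP ->//|/eqP -> /=|/lc //].
    by split; [exact: cheb_gen_subalg|exact: y_cheb].
- have [k [s0 [l [-> s0h l0 s0v lP]]]] := IH (path_sorted sv).
  by exists k.+1, s0, l.
Qed.

Let stack_free s : s != [::] -> valid s -> tau (stack_value s) = 0.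
Proof.
move=> s0 /stack_alternating[k [s1 [l [sE s1h l0 s1v [ls lc]]]]].
rewrite sE stack_value_run// s1v.
case: k sE => [|k] sE.
  rewrite mul1r; apply: (free_alternating xy_free) => //.
  by case: s1 l0 sE {s1h s1v} => [_ sE|a s1 + _]; [rewrite sE in s0|case: (l)].
have -> : cheb v y k.+1 * \prod_(p <- l) p.2 =
  \prod_(p <- (false, cheb v y k.+1) :: l) p.2 by rewrite big_cons.
apply: (free_alternating xy_free) => //.
  by case: s1 l0 {sE s1h s1v} => [/eqP -> //|_ _]; case: (l) ls => //= p l' -> ->.
move=> p; rewrite inE => /predU1P[-> /=|/lc //].
by split; [exact: cheb_gen_subalg|exact: y_cheb].
Qed.

Local Notation kappa := (fun t : bool => if t then 0 else v).

(** [split_sum] with an extra factor [a] at the right end of the word, where the stack sits during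
    the induction. *)
Let dyson (w : seq bool) (a : A) : C := \sum_(p < size w)
  kappa (nth false w p) * (tau (word z (take p w)) * tau (word z (drop p.+1 w) * a)).

Let dysonP w c a b : dyson w (c *: a + b) = c * dyson w a + dyson w b.
Proof.
rewrite /dyson mulr_sumr -big_split; apply: eq_bigr => p _ /=.
set W := word _ (drop _ _).
have -> : W * (c *: a + b) = c *: (W * a) + W * b by rewrite mulrDr -scalerAr.
by rewrite tauD tauZ; case: ifP => _; ring.
Qed.

Let dyson_rcons w t a : dyson (rcons w t) a =
  dyson w (z t * a) + kappa t * (tau (word z w) * tau a).
Proof.
rewrite /dyson size_rcons big_ord_recr/= nth_rcons ltnn eqxx; congr (_ + _).
  apply: eq_bigr => p _; rewrite nth_rcons ltn_ord drop_rcons ?ltn_ord// -cats1.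
  by rewrite takel_cat 1?ltnW// word_rcons; congr (_ * (_ * tau _)); rewrite mulrA.
by rewrite -cats1 take_size_cat// drop_oversize ?size_cat ?addn1// word_nil mul1r.
Qed.

Let mul_x s : x * stack_value s = stack_value (Some 1%N :: s) + tau x *: stack_value s.
Proof. by rewrite stackS /centred_pow expr1 mulrBl -scalerAl mul1r subrK. Qed.

Let mul_xtop e s : x * stack_value (Some e :: s) = stack_value (Some e.+1 :: s) +
  tau (x ^+ e.+1) *: stack_value s +
  (- tau (x ^+ e)) *: (stack_value (Some 1%N :: s) + tau x *: stack_value s).
Proof.
rewrite -mul_x !stackS mulrA mul_centred_pow mulrBl mulrDl -!scalerAl mul1r.
by rewrite scaleNr.
Qed.

Let mul_ytop s : y * stack_value (None :: s) =
  stack_value [:: None, None & s] + v *: stack_value s.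
Proof. by rewrite stackNN subrK. Qed.

Let mul_yS e s : y * stack_value (Some e :: s) =
  stack_value [:: None, Some e & s].
Proof. by rewrite stackNS. Qed.

(* The bottom [None] is cancelled by a unique letter [y] of [w]. *)
Let stack_dyson w s : valid s ->
  tau (word z w * stack_value (rcons s None)) = dyson w (stack_value s).
Proof.
have valid_rcons u : valid u -> valid (rcons u None).
  by case: u => //= a u; rewrite rcons_path => ->; rewrite andbF.
elim/last_ind: w s => [|w t IH] s sv.
  rewrite word_nil mul1r /dyson big_ord0 stack_free ?valid_rcons//.
  by case: (s).
rewrite word_rcons -mulrA dyson_rcons.
have D0 c a b : tau (word z w * (a + c *: b)) = tau (word z w * a) + c * tau (word z w * b).
  by rewrite mulrDr -scalerAr tauD tauZ.
have D1 c a b : dyson w (a + c *: b) = dyson w a + c * dyson w b.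
  by rewrite addrC dysonP addrC.
have IH' u : valid u -> tau (word z w * stack_value (rcons u None)) =
  dyson w (stack_value u) by exact: IH.
case: t.
  rewrite mul0r addr0; case: s sv => [|[e|] s] sv.
  - by rewrite (mul_x [:: None]) (mul_x [::]) !D0 !D1 -!IH.
  - have sv' := path_sorted sv; have sv1 n : valid (Some n :: s) by case: (s) sv.
    by rewrite rcons_cons !mul_xtop !(D0, D1) -!rcons_cons !IH.
  - by rewrite !mul_x !D0 !D1 -!rcons_cons !IH.
(* For a letter [y], the extra term of [dyson_rcons] carries [tau (stack_value s)]: it vanishes by
   freeness unless [s] is empty, when the letter cancels the bottom [None]. *)
case: s sv => [|[e|] s] sv.
- have s0 : stack_value [::] = 1 by [].
  rewrite [rcons _ _]/= (mul_ytop [::]) D0 (IH [:: None])//.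
  by rewrite s0 !mulr1 tau1 mulr1 stack1.
- by rewrite stack_free// !mulr0 addr0 rcons_cons !mul_yS -!rcons_cons IH.
- have sv' := path_sorted sv; have sv1 : valid [:: None, None & s] by case: (s) sv.
  by rewrite stack_free// !mulr0 addr0 rcons_cons !mul_ytop D0 D1 -!rcons_cons !IH.
Qed.

(** Traciality moves the leading [y] to the right end, where it is the stack reduced to its bottom
    [None]. *)
Lemma free_semicircular_dyson (w : seq bool) :
  tau (word z (false :: w)) = split_sum false kappa (fun u => tau (word z u)) w.
Proof.
rewrite word_cons tau_trace -[X in _ * X]stack1 (@stack_dyson w [::])//.
by apply: eq_bigr => p _; rewrite mulr1.
Qed.

End FreeSemicircular.

(** * Convergence of mixed moments *)

Section Convergence.
Variable R : realType.

Definition tends (u : nat -> R[i]) (l : R[i]) : Prop :=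
  u n @[n --> \oo] --> (l : R[i]^o).

Lemma eq_tends u w (l : R[i]) : u =1 w -> tends u l -> tends w l.
Proof. by move=> /funext ->. Qed.

Lemma tends_cst (l : R[i]) : tends (fun=> l) l.
Proof. exact: (@cvg_cst (R[i]^o)). Qed.

Lemma tendsP (u : nat -> R[i]) (l : R[i]) : tends u l <->
  forall e, 0 < e -> exists N, forall n, (N <= n)%N -> `|u n - l| < e.
Proof.
have h := @cvgrPdist_lt _ (R[i]^o) nat \oo eventually_filter u l; split.
  case: h => h _ /h ul e /ul [N _ hN]; exists N => n /hN.
  by rewrite distrC.
case: h => _ h ul; apply: h => e /ul [N hN]; exists N => // n /hN.
by rewrite distrC.
Qed.

Lemma tendsD u w (l m : R[i]) : tends u l -> tends w m -> tends (fun n => u n + w n) (l + m).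
Proof.
move=> /tendsP ul /tendsP wm; apply/tendsP => e e0.
have e2 : 0 < e / 2 by rewrite divr_gt0.
have [N1 h1] := ul _ e2; have [N2 h2] := wm _ e2.
exists (maxn N1 N2) => n; rewrite geq_max => /andP[/h1 u1 /h2 w2].
rewrite opprD addrACA (le_lt_trans (ler_normD _ _))// [ltRHS]splitr.
exact: ltrD.
Qed.

Lemma tendsM u w (l m : R[i]) : tends u l -> tends w m -> tends (fun n => u n * w n) (l * m).
Proof. by move=> ul wm; exact: (@cvgZ _ (R[i]^o) nat \oo _ u w l m ul wm). Qed.

Lemma tends_sum (I : Type) (r : seq I) (u : I -> nat -> R[i]) (l : I -> R[i]) :
  (forall i, tends (u i) (l i)) ->
  tends (fun n => \sum_(i <- r) u i n) (\sum_(i <- r) l i).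
Proof.
move=> ul; elim: r => [|i r IH].
  by rewrite big_nil (_ : (fun _ => _) = fun=> 0);
    [exact: tends_cst|apply/funext => n; rewrite big_nil].
have h := tendsD (ul i) IH; rewrite big_cons (_ : (fun _ => _) =
  fun n => u i n + \sum_(i <- r) u i n) => [//|].
by apply/funext => n; rewrite big_cons.
Qed.

Lemma tends_inv_sqrt (K : R[i]) : 0 <= K -> tends (fun n => K / sqrtC n%:R) 0.
Proof.
move=> K0; apply/tendsP => e e0.
(* For positive [n], the bound drops below [e] as soon as [n] exceeds [(K / e) ^+ 2], a nonnegative
   real. *)
pose x := complex.Re ((K / e) ^+ 2).
have Ke0 : 0 <= (K / e) ^+ 2 by rewrite exprn_ge0// divr_ge0// ltW.
have xE : (K / e) ^+ 2 = x%:C by rewrite RRe_real// ger0_real.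
exists (Num.bound x).+1 => // n /= xn.
have n0 : (0 < n)%N by apply: leq_trans xn.
have s0 : 0 < sqrtC (n%:R : R[i]) by rewrite sqrtC_gt0 ltr0n.
rewrite subr0 ger0_norm; last by rewrite divr_ge0// ltW.
rewrite ltr_pdivrMr// mulrC -ltr_pdivrMr//.
rewrite -(@ltr_pXn2r _ 2) ?nnegrE ?divr_ge0// ?(ltW e0) ?(ltW s0)//.
rewrite sqrtCK xE -(rmorph_nat (real_complex R)) ltcR.
have x0 : 0 <= x by rewrite -lecR -xE.
apply: lt_le_trans (archi_boundP x0) _.
by rewrite ler_nat ltnW.
Qed.

Lemma tends_close (u w : nat -> R[i]) (l K : R[i]) : 0 <= K ->
  (forall n, (0 < n)%N -> `|u n - w n| <= K / sqrtC n%:R) -> tends w l -> tends u l.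
Proof.
move=> K0 uw wl; have uw0 : tends (fun n => u n - w n) 0.
  apply/tendsP => e e0; have /tendsP/(_ e e0) [N hN] := tends_inv_sqrt K0.
  exists N.+1 => n Nn; have n0 : (0 < n)%N by apply: leq_trans Nn.
  rewrite subr0; apply: le_lt_trans (uw n n0) _; have := hN n (ltnW Nn).
  by rewrite subr0 ger0_norm// divr_ge0// sqrtC_ge0 ler0n.
have := tendsD uw0 wl; rewrite add0r.
by rewrite (_ : (fun _ => _) = u)//; apply/funext => n; rewrite subrK.
Qed.

(** Induction on the length: a rotation brings an occurrence of [y] to the front, and the equation
    then involves strictly shorter words only. *)
Lemma dyson_tends (T : eqType) (y : T) (kappa : T -> R[i])
    (F : nat -> seq T -> R[i]) (G : seq T -> R[i]) :
  (forall n u v, F n (u ++ v) = F n (v ++ u)) ->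
  (forall u v, G (u ++ v) = G (v ++ u)) ->
  (forall w, exists2 K : R[i], 0 <= K & forall n, (0 < n)%N ->
     `|F n (y :: w) - split_sum y kappa (F n) w| <= K / sqrtC n%:R) ->
  (forall w, G (y :: w) = split_sum y kappa G w) ->
  (forall w, y \notin w -> tends (F^~ w) (G w)) ->
  forall w, tends (F^~ w) (G w).
Proof.
move=> Ft Gt Fd Gd F0 w; have [k] := ubnP (size w); elim: k w => // k IH w wk.
have [yw|/F0//] := boolP (y \in w); case/splitPr: yw wk => u v wk.
have -> : (F^~ (u ++ y :: v)) = (F^~ (y :: (v ++ u))).
  by apply/funext => n; rewrite Ft.
rewrite Gt/= Gd; have [K K0 FK] := Fd (v ++ u).
apply: (tends_close K0 FK); apply: tends_sum => p; apply: tendsM; first exact: tends_cst.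
have sE : (size (v ++ u) < k)%N.
  by move: wk; rewrite !size_cat/= addnS ltnS addnC.
apply: tendsM; apply: IH.
  by rewrite size_take ltn_ord (leq_trans (ltn_ord p))// ltnW.
by rewrite size_drop (leq_ltn_trans (leq_subr _ _)).
Qed.

End Convergence.

(** * Standardisation *)

Section Variance.
Variables (C : numClosedFieldType) (A : ncProbSpaceType C).

Lemma varE (x : A) : var x = tau (x ^+ 2) - tau x ^+ 2.
Proof.
rewrite /var expr2 mulrBl !mulrBr -!scalerAl -!scalerAr !mul1r !mulr1 -expr2.
have tauB (u w : A) : tau (u - w) = tau u - tau w by rewrite raddfB.
by rewrite !tauB !tauZ tau1; ring.
Qed.

End Variance.

Section Standardisation.
Variables (C : numClosedFieldType) (A : ncProbSpaceType C).

Lemma var_tensor_sq (x : A) : var (x ⊗ x : (A ⊗ A)%type) =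
  var x * (var x + 2 * tau x ^+ 2).
Proof.
transitivity (tau (x ^+ 2) * tau (x ^+ 2) - (tau x * tau x) ^+ 2); last first.
  by rewrite varE; ring.
apply: etrans (varE _) _; congr (_ - _ ^+ 2); last exact: tauE.
by rewrite -tauE !expr2 tens_mulE.
Qed.

Lemma tau_affine (x y : A) (c d : C) e : (forall m, tau (x ^+ m) = tau (y ^+ m)) ->
  tau ((c *: (x - d%:A)) ^+ e) = tau ((c *: (y - d%:A)) ^+ e).
Proof.
move=> xy; rewrite !exprZn !tauZ; congr (_ * _).
(* The left factor [x ^+ f] lets the factors [x - d%:A] be expanded one at a time. *)
suff H f : tau (x ^+ f * (x - d%:A) ^+ e) = tau (y ^+ f * (y - d%:A) ^+ e).
  by have := H 0%N; rewrite !expr0 !mul1r.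
elim: e f => [|e IH] f; first by rewrite !expr0 !mulr1.
have E (w : A) : w ^+ f * (w - d%:A) ^+ e.+1 =
    w ^+ f.+1 * (w - d%:A) ^+ e - d *: (w ^+ f * (w - d%:A) ^+ e).
  by rewrite !exprS mulrBl mulrBr -scalerAl mul1r -scalerAr !mulrA -exprSr exprS.
have tauB (u w : A) : tau (u - w) = tau u - tau w by rewrite raddfB.
by rewrite !E !tauB !tauZ !IH.
Qed.

End Standardisation.

Section SemicircularElement.
Variables (R : realType) (A : ncProbSpaceType R[i]) (y : A) (c : R).
Local Notation M := (moment (semicircle_prob R)).
Local Notation V := (cheb 1 ('X : {poly R})).
Hypothesis y_moment : forall m, tau (y ^+ m) = (c ^+ m * M m)%:C.

(** Up to the factor [c ^+ k], [cheb (c ^+ 2)%:C y k] is the [k]-th Chebyshev polynomial at [y / c],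
    so orthogonality applies; the homogeneous form used in the proof avoids dividing by [c]. *)
Lemma tau_cheb k : tau (cheb (c ^+ 2)%:C y k.+1) = 0.
Proof.
suff H j i : tau (y ^+ j * cheb (c ^+ 2)%:C y i) =
    (c ^+ (j + i) * poly_moment M ('X^j * V i))%:C.
  have := H 0%N k.+1; rewrite !expr0 !mul1r => ->.
  by rewrite poly_moment_cheb ?mulr0//; [exact: moment_semicircle_rec].
suff : tau (y ^+ j * cheb (c ^+ 2)%:C y i) =
    (c ^+ (j + i) * poly_moment M ('X^j * V i))%:C /\
  tau (y ^+ j * cheb (c ^+ 2)%:C y i.+1) =
    (c ^+ (j + i.+1) * poly_moment M ('X^j * V i.+1))%:C by case.
elim: i j => [|i IH] j.
  by rewrite !cheb0 !cheb1 !mulr1 -!exprSr !y_moment !poly_momentXn addn0 addn1.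
split; first by case: (IH j).
rewrite !chebSS !mulrBr scale1r !mulrA -!exprSr -scalerAr !raddfB/= linearZ/=.
rewrite (IH j.+1).2 (IH j).1 -rmorphM -rmorphB/= addSnnS; congr (_%:C).
by rewrite mulrBr; congr (_ - _); rewrite mulrA -exprD addnC !addnS !addn0 addnC.
Qed.

End SemicircularElement.

(** * The limit of the tensor-product sums *)

Section TensorLimit.
Variables (R : realType) (A : ncProbSpaceType R[i]) (b : nat -> A).
Local Notation M := (moment (semicircle_prob R)).

Hypothesis b_singleton : forall u i, count_mem i u = 1%N -> tau (word b u) = 0.
Hypothesis b_pair : forall (u v : seq nat) i, i \notin u -> i \notin v ->
  tau (b i * word b u * (b i * word b v)) = tau (word b u) * tau (word b v).
Variable bd : nat -> R[i].
Hypothesis b_bound : forall u, `|tau (word b u)| <= bd (size u).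

Lemma word_nseq (B : ncProbSpaceType R[i]) (T : eqType) (z : T -> B) m t :
  word z (nseq m t) = z t ^+ m.
Proof.
by elim: m => [|m IH]; rewrite /= ?word_nil ?expr0// word_cons IH exprS.
Qed.

Lemma tau_word_rot (B : ncProbSpaceType R[i]) (T : eqType) (z : T -> B) u v :
  tau (word z (u ++ v)) = tau (word z (v ++ u)).
Proof. by rewrite !word_cat tau_trace. Qed.

Local Notation s := (fun n => clt_sum (fun=> b) n tt).

(** With one letter the limiting equation is the Catalan recursion [moment_convolution], and the
    only word without that letter is empty. *)
Lemma free_clt_tends m : tends (fun n => tau (s n ^+ m)) (M m)%:C.
Proof.
have -> : (fun n => tau (s n ^+ m)) =
    (fun n => tau (word (clt_sum (fun=> b) n) (nseq m tt))).
  by apply/funext => n; rewrite word_nseq.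
rewrite -[X in M X](size_nseq m tt).
apply: (@dyson_tends R unit tt (fun=> 1)
  (fun n w => tau (word (clt_sum (fun=> b) n) w)) (fun w => (M (size w))%:C)).
- by move=> n u v; rewrite tau_word_rot.
- by move=> u v; rewrite !size_cat addnC.
- by move=> w; exact: free_clt.
- move=> w; rewrite /= (moment_convolution (moment_semicircle0 R) (@moment_semicircle_rec R)).
  rewrite rmorph_sum/=; apply: eq_bigr => p _.
  by rewrite mul1r rmorphM/= size_drop size_take ltn_ord.
- move=> [|[] w] // _; rewrite moment_semicircle0 (_ : (fun _ => _) = fun=> 1%:C).
    exact: tends_cst.
  by apply/funext => n; rewrite word_nil tau1.
Qed.

Variables alpha beta : R.
Local Notation letter := (tensor_letter b alpha%:C beta%:C).

Lemma clt_sum_true n : clt_sum letter n true = alpha%:C *: (s n ⊗ 1 + 1 ⊗ s n).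
Proof.
rewrite /clt_sum tpureZl tpureZr -scalerDr scalerA mulrC -scalerA; congr (_ *: _).
have sumL (r : seq nat) : (\sum_(j <- r) b j) ⊗ 1 = \sum_(j <- r) b j ⊗ 1 :> (A ⊗ A)%type.
  elim: r => [|j r IH]; last by rewrite !big_cons tpureDl IH.
  by rewrite !big_nil -(scale0r 0) tpureZl scale0r.
have sumR (r : seq nat) : 1 ⊗ (\sum_(j <- r) b j) = \sum_(j <- r) 1 ⊗ b j :> (A ⊗ A)%type.
  elim: r => [|j r IH]; last by rewrite !big_cons tpureDr IH.
  by rewrite !big_nil -(scale0r 0) tpureZr scale0r.
by rewrite sumL sumR -big_split/= scaler_sumr.
Qed.

(** The two legs commute and the trace factorises over them, as for independent classical variables:
    this is the source of the classical convolution in the limit. *)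
Lemma tau_sum_sqr (x : A) m : tau ((x ⊗ 1 + 1 ⊗ x : (A ⊗ A)%type) ^+ m) =
  \sum_(i < m.+1) 'C(m, i)%:R * (tau (x ^+ (m - i)) * tau (x ^+ i)).
Proof.
have XL k : (x ⊗ 1 : (A ⊗ A)%type) ^+ k = (x ^+ k) ⊗ 1.
  by elim: k => [|k IH]; rewrite ?expr0// !exprS IH tens_mulE mulr1.
have XR k : (1 ⊗ x : (A ⊗ A)%type) ^+ k = 1 ⊗ (x ^+ k).
  by elim: k => [|k IH]; rewrite ?expr0// !exprS IH tens_mulE mulr1.
rewrite exprDn_comm; last by rewrite /GRing.comm !tens_mulE !mulr1 !mul1r.
rewrite raddf_sum; apply: eq_bigr => i _ /=.
by rewrite raddfMn/= XL XR tens_mulE mulr1 mul1r tauE mulr_natl.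
Qed.

Lemma tensor_clt_true m :
  tends (fun n => tau (word (clt_sum letter n) (nseq m true)))
    (alpha ^+ m * \sum_(i < m.+1) 'C(m, i)%:R * (M (m - i) * M i))%:C.
Proof.
rewrite (_ : (fun n => _) = fun n => alpha%:C ^+ m *
    \sum_(i < m.+1) 'C(m, i)%:R * (tau (s n ^+ (m - i)) * tau (s n ^+ i))); last first.
  apply/funext => n; rewrite word_nseq.
  by rewrite clt_sum_true exprZn tauZ tau_sum_sqr.
rewrite rmorphM rmorphXn rmorph_sum; apply: tendsM; first exact: tends_cst.
apply: tends_sum => i; rewrite rmorphM/= rmorph_nat; apply: tendsM; first exact: tends_cst.
by rewrite rmorphM; apply: tendsM; exact: free_clt_tends.
Qed.

Variables (B : ncProbSpaceType R[i]) (x y : B).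
Local Notation z := (fun t : bool => if t then x else y).
Hypothesis xy_free : free_family z.
Hypothesis x_moment : forall m, tau (x ^+ m) =
  (alpha ^+ m * \sum_(i < m.+1) 'C(m, i)%:R * (M (m - i) * M i))%:C.
Hypothesis y_moment : forall m, tau (y ^+ m) = (beta ^+ m * M m)%:C.

Lemma tensor_clt_tends w :
  tends (fun n => tau (word (clt_sum letter n) w)) (tau (word z w)).
Proof.
apply: (@dyson_tends R bool false (fun t => if t then 0 else (beta ^+ 2)%:C)
  (fun n w => tau (word (clt_sum letter n) w)) (fun w => tau (word z w))).
- by move=> n u v; rewrite tau_word_rot.
- by move=> u v; rewrite tau_word_rot.
- by move=> w'; rewrite rmorphXn; exact: (tensor_clt b_singleton b_pair b_bound).
- move=> w'; apply: free_semicircular_dyson => // k.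
  exact: tau_cheb.
- move=> w' fw; have -> : w' = nseq (size w') true.
    by elim: w' fw => //= -[] u IH; rewrite inE //= => /IH <-.
  by rewrite word_nseq x_moment; exact: tensor_clt_true.
Qed.

Lemma tensor_clt_sum_tends m :
  tends (fun n => tau ((clt_sum letter n true + clt_sum letter n false) ^+ m))
    (tau ((x + y) ^+ m)).
Proof.
(* The word on the right collects the letters as the power is expanded one factor at a time. *)
suff H w : tends (fun n => tau ((clt_sum letter n true + clt_sum letter n false) ^+ m *
    word (clt_sum letter n) w)) (tau ((x + y) ^+ m * word z w)).
  have := H [::]; rewrite word_nil mulr1.
  by under eq_fun do rewrite word_nil mulr1.
elim: m w => [|m IH] w.
  rewrite expr0 mul1r; under eq_fun do rewrite expr0 mul1r.
  exact: tensor_clt_tends.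
have E (D : ncProbSpaceType R[i]) (f : bool -> D) :
    tau ((f true + f false) ^+ m.+1 * word f w) =
    tau ((f true + f false) ^+ m * word f (true :: w)) +
    tau ((f true + f false) ^+ m * word f (false :: w)).
  by rewrite !word_cons -tauD -mulrDr -mulrDl exprSr !mulrA.
have h := tendsD (IH (true :: w)) (IH (false :: w)).
rewrite (E _ z); suff -> : (fun n => tau ((clt_sum letter n true +
    clt_sum letter n false) ^+ m.+1 * word (clt_sum letter n) w)) =
  (fun n => tau ((clt_sum letter n true + clt_sum letter n false) ^+ m *
      word (clt_sum letter n) (true :: w)) +
    tau ((clt_sum letter n true + clt_sum letter n false) ^+ m *
      word (clt_sum letter n) (false :: w))) by [].
by apply/funext => n; rewrite (E _ (clt_sum letter n)).
Qed.

End TensorLimit.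

Lemma real_sqrtC (R : realType) n : (Num.sqrt n%:R : R)%:C = sqrtC n%:R.
Proof.
rewrite -(rmorph_nat (real_complex R)) -[in RHS](@sqr_sqrtr R n%:R) ?ler0n//.
by rewrite rmorphXn sqrCK// lecR sqrtr_ge0.
Qed.

(** * Standardised free copies and the splitting of the normalised sum *)

Section StandardCopies.
Variables (R : realType) (A : ncProbSpaceType R[i]) (a : A) (lambda s : R).
Hypothesis a_mean : tau a = lambda%:C.
Hypothesis a_var : var a = (s ^+ 2)%:C.
Hypothesis s_neq0 : s != 0.
Variable a_ : nat -> A.
Hypothesis a_copies : free_copies a a_.

Definition standard_copy (k : nat) : A := (s^-1)%:C *: (a_ k - lambda%:C%:A).
Local Notation b := standard_copy.

Lemma standard_copyE k : a_ k = s%:C *: b k + lambda%:C%:A.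
Proof.
by rewrite /standard_copy scalerA -rmorphM mulfV// scale1r subrK.
Qed.

Lemma standard_copy_tensor k :
  a_ k ⊗ a_ k - ((lambda ^+ 2)%:C)%:A =
  (lambda * s)%:C *: (b k ⊗ 1 + 1 ⊗ b k) + (s ^+ 2)%:C *: (b k ⊗ b k)
  :> (A ⊗ A)%type.
Proof.
rewrite standard_copyE; move: (b k) => u.
rewrite tpureDl !tpureDr !tpureZl !tpureZr !scalerA -!rmorphM -!expr2.
rewrite (mulrC s lambda) -[(_)%:A]/(_ *: (1 ⊗ 1)) !addrA addrK scalerDr.
by rewrite -addrA addrC.
Qed.

Lemma standard_copy_sum (delta alpha beta : R) n : delta != 0 ->
  lambda * s = delta * alpha -> s ^+ 2 = delta * beta ->
  (delta * Num.sqrt n%:R)^-1%:C *: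
    \sum_(k < n) (a_ k ⊗ a_ k - ((lambda ^+ 2)%:C)%:A : (A ⊗ A)%type) =
  clt_sum (tensor_letter b alpha%:C beta%:C) n true +
  clt_sum (tensor_letter b alpha%:C beta%:C) n false.
Proof.
move=> d0 da db; rewrite /clt_sum -[RHS]scalerDr.
rewrite -[in RHS]big_split [in RHS]big_mkord -real_sqrtC -fmorphV invfM mulrC rmorphM.
rewrite -scalerA; congr (_ *: _); rewrite scaler_sumr; apply: eq_bigr => k _.
rewrite standard_copy_tensor da db scalerDr !scalerA -!rmorphM/=.
by rewrite !mulKf.
Qed.

Lemma standard_copy_gen k : gen_subalg [set a_ k] (b k).
Proof.
apply: gen_subalgZ; rewrite addrC -scaleNr; apply: gen_subalgP.
  exact: gen_subalg1.
exact: gen_subalg_sub.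
Qed.

Lemma standard_copy_moment k e : tau (b k ^+ e) = tau (((s^-1)%:C *: (a - lambda%:C%:A)) ^+ e).
Proof. by case: a_copies => _ _ h; apply: tau_affine => m. Qed.

Lemma standard_copy_mean k : tau (b k) = 0.
Proof.
rewrite -[b k]expr1 standard_copy_moment expr1 tauZ raddfB/= a_mean.
by rewrite tau_scalar subrr mulr0.
Qed.

Lemma standard_copy_var k : tau (b k ^+ 2) = 1.
Proof.
rewrite standard_copy_moment exprZn tauZ -a_mean -/(var a) a_var -rmorphXn -rmorphM/=.
by rewrite -exprMn mulVf// expr1n.
Qed.

Let a_free : free_family a_. Proof. by case: a_copies. Qed.

Lemma standard_copy_singleton u i : count_mem i u = 1%N -> tau (word b u) = 0.
Proof. exact: (free_singleton a_free standard_copy_gen standard_copy_mean). Qed.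

Lemma standard_copy_pair (u v : seq nat) i : i \notin u -> i \notin v ->
  tau (b i * word b u * (b i * word b v)) = tau (word b u) * tau (word b v).
Proof.
move=> iu iv; rewrite (free_pair a_free standard_copy_gen standard_copy_mean iu iv).
by rewrite standard_copy_var mul1r.
Qed.

Lemma standard_copy_bound : exists bd : nat -> R[i],
  forall u, `|tau (word b u)| <= bd (size u).
Proof.
have [bd h] := choice (free_word_bound a_free standard_copy_gen standard_copy_mean
  standard_copy_moment).
by exists bd => u; exact: h.
Qed.

End StandardCopies.

Theorem theorem1p1 (R : realType) (A : ncProbSpaceType R[i]) (a : A)
    (lambda sigma : R)
    (a_sa : self_adjoint a)
    (a_mean : tau a = lambda%:C)
    (a_var : var a = (sigma ^+ 2)%:C)
    (sigma_neq0 : sigma ^+ 2 != 0) :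
  let delta := Num.sqrt (complex.Re (var (a ⊗ a))) in
  let q := 2 * lambda ^+ 2 / (sigma ^+ 2 + 2 * lambda ^+ 2) in
  [/\ var (a ⊗ a) = (delta ^+ 2)%:C,
      delta ^+ 2 = sigma ^+ 2 * (sigma ^+ 2 + 2 * lambda ^+ 2),
      0 <= q <= 1 &
      forall (a_ : nat -> A), free_copies a a_ ->
      forall mu_q : probability (measurableTypeR R) R,
        is_free_conv
          (dilation (Num.sqrt q)
            (classical_conv
              (dilation (Num.sqrt 2)^-1 (semicircle_prob R))
              (dilation (Num.sqrt 2)^-1 (semicircle_prob R))))
          (dilation (Num.sqrt (1 - q)) (semicircle_prob R))
          mu_q ->
        cvg_in_distribution
          (fun n : nat => (delta * Num.sqrt n%:R)^-1%:C *:
            \sum_(k < n) (a_ k ⊗ a_ k - ((lambda ^+ 2)%:C)%:A) : (A ⊗ A)%type)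
          mu_q].
Proof.
move=> delta q.
have sg0 : sigma != 0 by move: sigma_neq0; rewrite expf_eq0.
have s2 : 0 < sigma ^+ 2 by rewrite lt_def sigma_neq0 sqr_ge0.
have l2 : 0 <= lambda ^+ 2 by exact: sqr_ge0.
set E := sigma ^+ 2 + 2 * lambda ^+ 2 in q *.
have E0 : 0 < E by rewrite ltr_pwDl// mulr_ge0.
have D0 : 0 < sigma ^+ 2 * E by rewrite mulr_gt0.
have vE : var (a ⊗ a : (A ⊗ A)%type) = (sigma ^+ 2 * E)%:C.
  rewrite var_tensor_sq a_var a_mean /E.
  by rewrite !(rmorphM, rmorphD, rmorphXn, rmorph_nat).
have d2 : delta ^+ 2 = sigma ^+ 2 * E.
  by rewrite /delta vE sqr_sqrtr//= ltW.
have d0 : 0 < delta by rewrite /delta vE sqrtr_gt0.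
have q01 : 0 <= q <= 1.
  apply/andP; split; first by apply: divr_ge0; [apply: mulr_ge0|exact: ltW].
  by rewrite ler_pdivrMr// mul1r /E lerDr ltW.
split => //; first by rewrite vE d2.
(* The free convolution is given through a realisation [x], [y]; the moments of [x + y] serve as the
   limits. *)
move=> a_ a_copies mu_q [B [x [y [_ xy_free [_ x_law] [_ y_law] [_ xy_law]]]]] m.
rewrite -xy_law.
(* The sign of [s] is chosen to make [alpha] nonnegative, hence equal to the square root of
   [q / 2]. *)
have [s s_sq ls0] : exists2 s, s ^+ 2 = sigma ^+ 2 & 0 <= lambda * s.
  have [h|/ltW h] := leP 0 (lambda * sigma); first by exists sigma.
  by exists (- sigma); rewrite ?sqrrN// mulrN oppr_ge0.
have s0 : s != 0 by rewrite -sqrf_eq0 s_sq.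
pose alpha := lambda * s / delta; pose beta := sigma ^+ 2 / delta.
have E' : E != 0 by rewrite gt_eqF.
have alpha0 : 0 <= alpha by rewrite divr_ge0// ltW.
have alphaE : alpha = Num.sqrt q * (Num.sqrt 2)^-1.
  have [q0 _] := andP q01.
  apply/eqP; rewrite -(@eqrXn2 _ 2 _ _ isT alpha0) ?mulr_ge0 ?invr_ge0 ?sqrtr_ge0//.
  rewrite /alpha !exprMn !exprVn d2 !sqr_sqrtr// s_sq /q; apply/eqP.
  by field; rewrite E' sg0.
have beta2 : beta ^+ 2 = 1 - q.
  have lE : 2 * lambda ^+ 2 = E - sigma ^+ 2 by rewrite /E addrC addKr.
  by rewrite /beta exprMn exprVn d2 /q lE; field; rewrite E' sg0.
have betaE : beta = Num.sqrt (1 - q).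
  by rewrite -beta2 sqrtr_sqr ger0_norm// divr_ge0// ltW.
have msc := @integrable_semicircleX R.
have mdil := has_moments_dilation _ msc.
have x_moment k : tau (x ^+ k) = (alpha ^+ k * \sum_(i < k.+1)
    'C(k, i)%:R * (moment (semicircle_prob R) (k - i) * moment (semicircle_prob R) i))%:C.
  rewrite x_law moment_dilation; last exact: has_moments_conv.
  congr (_%:C); rewrite (moment_conv _ (mdil _) (mdil _)) alphaE exprMn -mulrA.
  congr (_ * _); rewrite mulr_sumr.
  (* The dilation factors with exponents [k - i] and [i] recombine into a [k]-th power. *)
  apply: eq_bigr => i _; rewrite !(moment_dilation _ _ msc).
  rewrite [RHS]mulrCA; congr (_ * _); rewrite mulrACA; congr (_ * _).
  by rewrite -exprD subnK// -ltnS ltn_ord.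
have y_moment k : tau (y ^+ k) = (beta ^+ k * moment (semicircle_prob R) k)%:C.
  by rewrite y_law moment_dilation// betaE.
have [bd bdP] := standard_copy_bound s a_mean a_copies.
have a_var' : var a = (s ^+ 2)%:C by rewrite s_sq.
apply: eq_tends (tensor_clt_sum_tends (standard_copy_singleton s a_mean a_copies)
  (standard_copy_pair a_mean a_var' s0 a_copies) bdP xy_free x_moment y_moment (m := m)) => n.
congr (tau (_ ^+ _)).
apply/esym/standard_copy_sum => //; first by rewrite gt_eqF.
  by rewrite /alpha [RHS]mulrC divfK// gt_eqF.
by rewrite s_sq /beta [RHS]mulrC divfK// gt_eqF.
Qed.
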